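(* In the Bayesian $k$-armed bandit problem described in the context, suppose the prior $\Gamma$ is $1$-regular and every $P_\mu$ is $1$-subgaussian, and Seq-Greedy is executed with parameter $\upsilon=2\delta$. Then: (i) for Bernoulli rewards ($P_\mu$ Bernoulli with mean $\mu$) and $\delta=\tilde\Theta(\max(k^{-1},T^{-1/2}))$, $BR_{T,k}(\text{Seq-Greedy})\le\tilde O(\max[\sqrt T,T/k])$; (ii) for general $1$-subgaussian rewards and $\delta=\tilde\Theta(\max(k^{-1/3},T^{-1/4}))$, $BR_{T,k}(\text{Seq-Greedy})\le\tilde O(\max[T^{3/4},T/k^{1/3}])$; (iii) for uniformly upward-looking reward families and $\delta=\tilde\Theta(\max(k^{-1/2},T^{-1/3}))$, $BR_{T,k}(\text{Seq-Greedy})\le\tilde O(\max[T^{2/3},T/k^{1/2}])$.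
   Context: Bayesian $k$-armed bandit: horizon $T$, arms $[k]$, family $\mathcal{F}=\{P_\mu:\mu\in[0,1]\}$ with $P_\mu$ of mean $\mu$; prior $\Gamma$ on $[0,1]$ with density; means i.i.d. $\sim\Gamma$; pulling arm $i$ at time $t$ gives $Y_{it}\sim P_{\mu_i}$ independently, only the pulled reward observed. $R_T(\pi\mid\bm\mu)=T\max_i\mu_i-\sum_t\mathbb{E}[\mu_{a_t}\mid\pi]$, $BR_{T,k}(\pi)=\mathbb{E}[R_T(\pi\mid\bm\mu)]$. $1$-regular: there are $0<c_0<C_0$ with $c_0\epsilon\le\mathbb{P}_\Gamma(\mu>1-\epsilon)\le\mathbb{P}_\Gamma(\mu\ge1-\epsilon)\le C_0\epsilon$ for $\epsilon\in(0,1]$. $1$-subgaussian: $\mathbb{E}[e^{s(Z-\mu)}]\le e^{s^2/2}$ for $Z\sim P_\mu$. A distribution $Q$ of mean $\mu$ with $Q-\mu$ $1$-subgaussian is upward-looking with parameter $p_0$ if, with $X_i$ i.i.d. $\sim Q$, $R_n(\theta)=\sum_{i\le n}X_i-n\theta$, $\tau(\theta)=\inf\{n\ge1:R_n(\theta)<0\text{ or }R_n(\theta)\ge1\}$, for every $\theta<\mu$ either $\mathbb{P}[R_{\tau(\theta)}(\theta)\ge1]\ge p_0$ or $\mathbb{E}[(X_1-\theta)\mathbf 1(X_1\ge\theta)]\ge p_0$; $\mathcal{F}$ is uniformly upward-looking with parameters $(p_0,\delta_0)$ if $P_\mu$ is upward-looking with parameter $p_0$ for all $\mu\ge1-\delta_0$.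 Seq-Greedy with input $\upsilon$: set $i=1$, pull arm 1 at $t=1$; for $t\ge2$: if the empirical mean $\hat\mu_i(t-1)\ge1-\upsilon$ pull arm $i$; else if $i<k$ pull arm $i+1$ and set $i\leftarrow i+1$; else pull $\arg\max_j\hat\mu_j(t-1)$. $\tilde O,\tilde\Theta$ hide polylogarithmic factors and constants. *)

(* Defs.v *)
From HB Require Import structures.
From mathcomp Require Import all_boot all_order all_algebra.
From mathcomp Require Import all_classical all_reals all_analysis.
From mathcomp Require Import measurable_realfun.
Set Implicit Arguments. Unset Strict Implicit. Unset Printing Implicit Defensive.
Import Order.TTheory GRing.Theory Num.Theory.
Import numFieldNormedType.Exports.
Local Open Scope classical_set_scope.
Local Open Scope ring_scope.

Section Bandit.
Variable R : realType.

(* ---------- iterated integral over a finite list of probability measures on R: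
   iint [:: p1; ...; pn] f = \int[p1]_x1 ... \int[pn]_xn f [:: x1; ...; xn]
   (= integral of f against the product measure p1 x ... x pn) *)
Fixpoint iint (ps : seq (probability R R)) (f : seq R -> \bar R) : \bar R :=
  match ps with
  | [::] => f [::]
  | p :: ps' => (\int[p]_x iint ps' (fun xs => f (x :: xs)))%E
  end.

Definition has_mean (Q : probability R R) (mu : R) : Prop :=
  (\int[Q]_x (x%:E) = mu%:E)%E.

Definition subgaussian1 (Q : probability R R) (mu : R) : Prop :=
  forall s : R, (\int[Q]_z (expR (s * (z - mu)))%:E <= (expR (s ^+ 2 / 2))%:E)%E.

Definition reward_family (P : R -> probability R R) : Prop :=
  forall mu, 0 <= mu <= 1 -> has_mean (P mu) mu.

Definition kernel_measurable (P : R -> probability R R) : Prop :=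
  forall A : set R, measurable A -> measurable_fun (`[0%R, 1%R]%classic : set R) (fun mu : R => P mu A : \bar R).

Definition family_subgaussian1 (P : R -> probability R R) : Prop :=
  forall mu, 0 <= mu <= 1 -> subgaussian1 (P mu) mu.

Definition bernoulli_family (P : R -> probability R R) : Prop :=
  forall mu, 0 <= mu <= 1 -> forall A : set R, measurable A ->
    P mu A = (mu%:E * \d_(1%R : R) A + (1 - mu)%R%:E * \d_(0%R : R) A)%E.

Definition prior_with_density (G : probability R R) : Prop :=
  G (`[0%R, 1%R]%classic : set R) = 1%E /\
  exists f : R -> R, measurable_fun setT f /\ (forall x, 0 <= f x) /\
    forall A : set R, measurable A ->
      G A = (\int[lebesgue_measure]_(x in A) (f x)%:E)%E.

Definition regular1 (G : probability R R) : Prop :=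
  exists c0 C0 : R, 0 < c0 < C0 /\
    forall eps : R, 0 < eps <= 1 ->
      ((c0 * eps)%:E <= G `](1 - eps)%R, +oo[%classic /\
       G `](1 - eps)%R, +oo[%classic <= G `[(1 - eps)%R, +oo[%classic /\
       G `[(1 - eps)%R, +oo[%classic <= (C0 * eps)%:E)%E.

Definition walk (theta : R) (ys : seq R) (m : nat) : R :=
  \sum_(i < m) nth 0 ys i - m%:R * theta.

(* indicator of the event {tau(theta) = n, R_n(theta) >= 1}, n >= 1 *)
Definition hit_up_at (theta : R) (n : nat) (ys : seq R) : bool :=
  [forall m : 'I_n, (0 < (m : nat))%N ==> (0 <= walk theta ys m) && (walk theta ys m < 1)]
  && (1 <= walk theta ys n).

(* P[R_tau(theta)(theta) >= 1] = sum_{n >= 1} P[tau = n, R_n >= 1] *)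
Definition hit_up_prob (Q : probability R R) (theta : R) : \bar R :=
  (\sum_(0 <= n <oo)
     iint (nseq n.+1 Q) (fun ys => (hit_up_at theta n.+1 ys)%:R%R%:E))%E.

Definition upward_looking (Q : probability R R) (mu p0 : R) : Prop :=
  has_mean Q mu /\ subgaussian1 Q mu /\
  forall theta : R, theta < mu ->
    (p0%:E <= hit_up_prob Q theta)%E \/
    (p0%:E <= \int[Q]_x ((x - theta) * ((theta <= x)%R)%:R)%R%:E)%E.

Definition uniformly_upward_looking (P : R -> probability R R) (p0 d0 : R) : Prop :=
  forall mu, 1 - d0 <= mu <= 1 -> upward_looking (P mu) mu p0.

Record sg_state := SGState { sg_cur : nat; sg_cnt : nat -> nat; sg_sum : nat -> R }.

Definition sg_init : sg_state := SGState 0 (fun _ => 0%N) (fun _ => 0).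

(* empirical mean (0 for an unpulled arm; never used in that case) *)
Definition emp (s : sg_state) (j : nat) : R :=
  if sg_cnt s j is 0%N then 0 else sg_sum s j / (sg_cnt s j)%:R.

(* argmax_j emp j over j < k, ties broken toward the smallest index *)
Definition emp_argmax (k : nat) (s : sg_state) : nat :=
  foldl (fun b j => if emp s b < emp s j then j else b) 0%N (iota 0 k).

(* (new current index, arm pulled) *)
Definition sg_choose (ups : R) (k : nat) (first : bool) (s : sg_state) : nat * nat :=
  if first then (0%N, 0%N)
  else if 1 - ups <= emp s (sg_cur s) then (sg_cur s, sg_cur s)
  else if ((sg_cur s).+1 < k)%N then ((sg_cur s).+1, (sg_cur s).+1)
  else (sg_cur s, emp_argmax k s).

(* x i n = reward of the n-th pull (0-based) of arm i *)
Definition sg_update (x : nat -> nat -> R) (c a : nat) (s : sg_state) : sg_state :=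
  SGState c (fun j => if j == a then (sg_cnt s j).+1 else sg_cnt s j)
            (fun j => if j == a then sg_sum s j + x a (sg_cnt s a) else sg_sum s j).

Fixpoint sg_run (ups : R) (k : nat) (x : nat -> nat -> R) (n : nat)
    (first : bool) (s : sg_state) : seq nat :=
  match n with
  | 0%N => [::]
  | n'.+1 => let ca := sg_choose ups k first s in
             ca.2 :: sg_run ups k x n' false (sg_update x ca.1 ca.2 s)
  end.

Definition seq_greedy_actions (ups : R) (k T : nat) (x : nat -> nat -> R) : seq nat :=
  sg_run ups k x T true sg_init.

Definition tape (T : nat) (xs : seq R) : nat -> nat -> R :=
  fun i n => nth 0 xs (i * T + n).

Definition tape_dists (P : R -> probability R R) (T k : nat) (mus : seq R)
  : seq (probability R R) :=
  flatten [seq nseq T (P (nth 0 mus i)) | i <- iota 0 k].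

Definition realized_regret (ups : R) (T k : nat) (mus xs : seq R) : R :=
  T%:R * \big[Num.max/nth 0 mus 0]_(i < k) nth 0 mus i
  - \sum_(a <- seq_greedy_actions ups k T (tape T xs)) nth 0 mus a.

Definition BR_seq_greedy (P : R -> probability R R) (G : probability R R)
    (T k : nat) (ups : R) : \bar R :=
  iint (nseq k G) (fun mus =>
    iint (tape_dists P T k mus) (fun xs => (realized_regret ups T k mus xs)%:E)).

Definition polylog (a : nat) (T k : nat) : R := (1 + ln ((T + k)%:R)) ^+ a.

Definition seq_greedy_rate (P : R -> probability R R) (G : probability R R)
    (dlevel bound : nat -> nat -> R) : Prop :=
  exists (C : R) (a : nat) (delta : nat -> nat -> R),
    0 < C /\
    (forall T k : nat, (0 < T)%N -> (0 < k)%N ->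
       dlevel T k / (C * polylog a T k) <= delta T k <= C * polylog a T k * dlevel T k) /\
    (forall T k : nat, (0 < T)%N -> (0 < k)%N ->
       (BR_seq_greedy P G T k (2 * delta T k) <= (C * polylog a T k * bound T k)%:E)%E).

End Bandit.

(* Main.v *)
(* Seq-Greedy abandons an arm as soon as its centred reward sum, the walk with
   increments X - (1 - 2 delta), becomes negative.  An arm with gap
   g = 1 - mu > 3 delta is abandoned after O(1 / g^2) expected pulls (Chernoff), so
   it costs O(1 / g), whose prior expectation is logarithmic by 1-regularity; all
   other arms cost at most 3 delta per pull.  If every arm with mu >= 1 - delta is
   kept for ever with probability at least r, then each explored arm is kept with
   probability at least q = r c0 delta, independently of the others, whence
     BR <= 3 delta T + O(log T) / q + T exp (- q k).
   Exponential supermartingales give r = delta^2 / 4 for general rewards, r of order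
   delta for upward-looking ones (a walk that has reached 1 survives with probability
   of order delta), and r constant for Bernoulli rewards (the walk first climbs by
   consecutive successes). *)

Require Import Defs.
From HB Require Import structures.
From mathcomp Require Import all_boot all_order all_algebra.
From mathcomp Require Import all_classical all_reals all_analysis.
From mathcomp Require Import measurable_realfun.
From mathcomp Require Import ring lra zify.
Set Implicit Arguments. Unset Strict Implicit. Unset Printing Implicit Defensive.
Import Order.TTheory GRing.Theory Num.Theory.
Local Open Scope ring_scope.

(* The library integral of a nonnegative function is a supremum over simple functions
   below it, hence a lower integral when the function is not measurable: it remains
   monotone, homogeneous and superadditive, and additive constants can be pulled out.
   This suffices for all the iterated integrals below, so that the measurability of
   the run of the algorithm in the rewards and the means is never needed. *)
Section LowerIntegral.
Context d (T : measurableType d) (R : realType).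
Variable m : {measure set T -> \bar R}.
Local Open Scope ereal_scope.
Implicit Types f g : T -> \bar R.
Import HBNNSimple.

Lemma integral_le_sintegral f (c : \bar R) : (forall x, 0 <= f x) ->
  (forall h : {nnsfun T >-> R}, (forall x, (h x)%:E <= f x) -> sintegral m h <= c) ->
  \int[m]_x f x <= c.
Proof.
by move=> f0 H; rewrite ge0_integralTE// ge_ereal_sup// => _ [h/= hf <-]; exact: H.
Qed.

Lemma sintegral_le_integral f (h : {nnsfun T >-> R}) :
  (forall x, (h x)%:E <= f x) -> sintegral m h <= \int[m]_x f x.
Proof.
move=> hf; rewrite ge0_integralTE//; last first.
  by move=> x; apply: le_trans (hf x); rewrite lee_fin fun_ge0.
by apply: ereal_sup_ubound; exists h.
Qed.

(** Since [g] is nonnegative, only the positive part of [f] matters. A simple function below it, cut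
    off to [A], keeps its integral and lies below [g]. *)
Lemma le_integral_ae (A : set T) f g : measurable A -> m (~` A)%classic = 0 ->
  (forall x, 0 <= g x) -> (forall x, A x -> f x <= g x) ->
  \int[m]_x f x <= \int[m]_x g x.
Proof.
move=> mA mA0 g0 fg.
apply: (@le_trans _ _ (\int[m]_x f^\+ x)).
  rewrite integralE -[leRHS]sube0 leeB// integral_ge0// => x _; exact: funeneg_ge0.
apply: integral_le_sintegral => [x|h hf]; first exact: funepos_ge0.
apply: (@le_trans _ _ (sintegral m (proj_nnsfun h mA))); last first.
  apply: sintegral_le_integral => x /=; rewrite mindicE.
  have [/set_mem xA|_] := boolP (x \in A); last by rewrite mulr0.
  rewrite mulr1 (le_trans (hf x))// funeposE ge_max g0 andbT; exact: fg.
rewrite -!integralT_nnsfun le_eqVlt; apply/orP; left; apply/eqP.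
apply: ge0_ae_eq_integral => //.
- exact/measurable_EFinP.
- exact/measurable_EFinP.
- by move=> x _; rewrite lee_fin fun_ge0.
- by move=> x _; rewrite lee_fin fun_ge0.
exists (~` A)%classic; split => //; first exact: measurableC.
move=> x /= H xA; apply: H => _ /=.
by rewrite mindicE mem_set// mulr1.
Qed.

Lemma le_integral_nomeas f g : (forall x, 0 <= g x) -> (forall x, f x <= g x) ->
  \int[m]_x f x <= \int[m]_x g x.
Proof. by move=> g0 fg; apply: (@le_integral_ae setT) => //; rewrite setCT measure0. Qed.

(** Simple functions below [f] and below [g] add up to one below [f + g]. The two suprema are taken
    in turn, once the infinite case is set aside so that subtraction is legitimate. *)
Lemma le_integralD_nomeas f g : (forall x, 0 <= f x) -> (forall x, 0 <= g x) ->
  \int[m]_x f x + \int[m]_x g x <= \int[m]_x (f x + g x).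
Proof.
move=> f0 g0.
have fg0 x : 0 <= f x + g x by rewrite adde_ge0.
have I0 : 0 <= \int[m]_x (f x + g x) by rewrite integral_ge0.
have [->|oo] := eqVneq (\int[m]_x (f x + g x)) +oo; first by rewrite leey.
have fin : \int[m]_x (f x + g x) \is a fin_num by rewrite ge0_fin_numE// ltey.
have K (h : {nnsfun T >-> R}) : (forall x, (h x)%:E <= g x) ->
    \int[m]_x f x + sintegral m h <= \int[m]_x (f x + g x).
  move=> hg.
  have hfin : sintegral m h \is a fin_num.
    rewrite ge0_fin_numE ?sintegral_ge0//.
    apply: (@le_lt_trans _ _ (\int[m]_x (f x + g x))); last by rewrite ltey.
    by apply: sintegral_le_integral => x; rewrite (le_trans (hg x))// leeDr.
  rewrite -leeBrDr//; apply: integral_le_sintegral => // h' h'f.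
  rewrite leeBrDr// -sintegralD//.
  by apply: (@sintegral_le_integral _ (h' \+ h)%R) => x /=; rewrite EFinD leeD.
have Ffin : \int[m]_x f x \is a fin_num.
  rewrite ge0_fin_numE ?integral_ge0//.
  apply: (@le_lt_trans _ _ (\int[m]_x (f x + g x))); last by rewrite ltey.
  by apply: le_integral_nomeas => // x; rewrite leeDl.
rewrite addeC -leeBrDr//; apply: integral_le_sintegral => // h hg.
by rewrite leeBrDr// addeC; exact: K.
Qed.

Lemma integralZ_nomeas f (a : R) : (0 <= a)%R -> (forall x, 0 <= f x) ->
  \int[m]_x (a%:E * f x) = a%:E * \int[m]_x f x.
Proof.
have K (b : R) g : (0 < b)%R -> (forall x, 0 <= g x) ->
    \int[m]_x (b%:E * g x) <= b%:E * \int[m]_x g x.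
  move=> b0 g0; apply: integral_le_sintegral => [x|h hf].
    by rewrite mule_ge0// lee_fin ltW.
  have bi : (0 <= b^-1)%R by rewrite invr_ge0 ltW.
  rewrite -lee_pdivrMl// -sintegralrM.
  apply: (@sintegral_le_integral _ (scale_nnsfun h bi)) => x /=.
  by rewrite EFinM lee_pdivrMl.
rewrite le_eqVlt => /predU1P[<-|a0] f0.
  by rewrite mul0e integral0_eq// => x _; rewrite mul0e.
apply/eqP; rewrite eq_le K//=.
have ai : (0 < a^-1)%R by rewrite invr_gt0.
rewrite -lee_pdivlMl//; apply: le_trans (K _ _ ai _); last first.
  by move=> x; rewrite mule_ge0// lee_fin ltW.
apply: le_integral_nomeas => x; rewrite muleA -EFinM mulVf ?gt_eqF// mul1e//.
Qed.

End LowerIntegral.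

(** * Integration against a probability measure *)

Section Probability.
Context d (T : measurableType d) (R : realType).
Variable p : probability T R.
Local Open Scope ereal_scope.
Implicit Types f g : T -> \bar R.
Import HBNNSimple.

Lemma integral_prob_cst (c : \bar R) : \int[p]_x c = c.
Proof.
have e : c * p setT = c by rewrite probability_setT mule1.
by rewrite -[RHS]e; apply: (integral_cst p _ c).
Qed.

Lemma integral_prob_le f (c : \bar R) : 0 <= c -> (forall x, f x <= c) ->
  \int[p]_x f x <= c.
Proof. by move=> c0 fc; rewrite -[leRHS]integral_prob_cst; exact: le_integral_nomeas. Qed.

(** This is the direction opposite to superadditivity. A simple [h] below [c + f] is at most [c]
    plus the measurable function [max (h - c) 0], which lies below [f]. *)
Lemma integral_prob_addl (c : R) f : (0 <= c)%R -> (forall x, 0 <= f x) ->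
  \int[p]_x (c%:E + f x) <= c%:E + \int[p]_x f x.
Proof.
move=> c0 f0.
apply: integral_le_sintegral => [x|h hf]; first by rewrite adde_ge0// lee_fin.
pose k x := (Num.max (h x - c) 0)%R.
have mk : measurable_fun setT k.
  apply: measurable_maxr; last exact: measurable_cst.
  exact: measurable_funB.
apply: (@le_trans _ _ (\int[p]_x (c%:E + (k x)%:E))).
  apply: sintegral_le_integral => x; rewrite -EFinD lee_fin /k.
  by rewrite -lerBlDl le_max lexx.
rewrite ge0_integralD//=; last 2 first.
- by move=> x _; rewrite lee_fin le_max lexx orbT.
- exact/measurable_EFinP.
rewrite integral_prob_cst leeD2l//; apply: le_integral_nomeas => // x.
have := hf x; have := f0 x; case: (f x) => [r| |] //= r0 hr.
  by rewrite lee_fin ge_max lerBlDl; rewrite !lee_fin in r0 hr; rewrite hr.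
by rewrite leey.
Qed.

End Probability.

(** * Pathwise domination of the regret by the costs of successive arms *)

Section Pathwise.
Variable R : realType.
Implicit Types (mu dl th w h : R) (mus xs : seq R).

(** Smaller gaps are paid for by the term [3 * dl] charged to every pull. *)
Definition big_gap dl mu : R := if 3 * dl < 1 - mu then 1 - mu else 0.

(* The remaining rewards of the arm are the first [n] entries of [xs]; the rest is
   the tape of the following arms, on which [cont] is run once the sum [w] turns
   negative. *)
Fixpoint arm_cost (c th : R) (cont : seq R -> R) (n : nat) (w : R) (xs : seq R) : R :=
  match n with
  | 0%N => 0
  | n'.+1 => let w' := w + (head 0 xs - th) in
      c + (if w' < 0 then cont (drop n' (behead xs))
           else arm_cost c th cont n' w' (behead xs))
  end.

(** Each arm gets its own budget of [T] pulls: forgetting the shared horizon only raises the cost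
    and decouples the arms. Once all arms are abandoned, the whole horizon is charged at 1 per
    pull. *)
Fixpoint explore_cost (dl : R) (T : nat) (mus xs : seq R) : R :=
  match mus with
  | [::] => T%:R
  | mu :: mus' => arm_cost (big_gap dl mu) (1 - 2 * dl) (explore_cost dl T mus') T 0 xs
  end.

Lemma big_gap_ge0 dl mu : 0 <= dl -> 0 <= big_gap dl mu.
Proof. by rewrite /big_gap; case: ifP => //; lra. Qed.

Lemma big_gap_le1 dl mu : 0 <= mu -> big_gap dl mu <= 1.
Proof. by rewrite /big_gap; case: ifP => //; lra. Qed.

Lemma gap_le_big_gap dl mu : 0 <= dl -> 1 - mu <= 3 * dl + big_gap dl mu.
Proof. by rewrite /big_gap; case: ltP; lra. Qed.

Lemma arm_cost_ge0 c th cont n w xs : 0 <= c -> (forall ys, 0 <= cont ys) ->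
  0 <= arm_cost c th cont n w xs.
Proof.
move=> c0 cont0; elim: n w xs => //= n IH w xs.
by rewrite addr_ge0//; case: ifP.
Qed.

Lemma explore_cost_ge0 dl T mus xs : 0 <= dl -> 0 <= explore_cost dl T mus xs.
Proof.
move=> dl0; elim: mus xs => [|mu mus IH] xs /=; first exact: ler0n.
by apply: arm_cost_ge0 => //; exact: big_gap_ge0.
Qed.

Lemma size_sg_run ups k x n b (s : sg_state R) : size (sg_run ups k x n b s) = n.
Proof. by elim: n b s => //= n IH b s; rewrite IH. Qed.

(** Induction on the remaining pulls [n]. The invariant says that arm [i] is current with [m] pulls
    and centred sum [w], and that later arms are untouched; arm [j] reads the tape block starting at
    [j * T]. The sign of [w] selects the next branch of the algorithm. *)
Lemma sg_run_cost_le dl T mus xs (D := fun i => big_gap dl (nth 0 mus i))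
    (th := 1 - 2 * dl) n (s : sg_state R) i m :
  0 <= dl -> all (fun mu => 0 <= mu) mus -> (n + m <= T)%N -> (0 < m)%N ->
  (i < size mus)%N -> sg_cur s = i -> sg_cnt s i = m ->
  (forall j, (i < j)%N -> sg_cnt s j = 0%N /\ sg_sum s j = 0) ->
  forall w, w = sg_sum s i - m%:R * th ->
  \sum_(a <- sg_run (2 * dl) (size mus) (tape T xs) n false s) D a <=
  if w < 0 then explore_cost dl T (drop i.+1 mus) (drop (i.+1 * T) xs)
  else arm_cost (D i) th (explore_cost dl T (drop i.+1 mus)) (T - m) w
         (drop (i * T + m) xs).
Proof.
move=> dl0 mus0.
have D0 j : 0 <= D j by exact: big_gap_ge0.
have D1 j : D j <= 1.
  apply: big_gap_le1; have [jk|jk] := ltnP j (size mus).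
    exact: (all_nthP 0 mus0).
  by rewrite nth_default.
elim: n s i m => [|n IH] s i m nT m0 ik cur cnt fresh w wE.
  rewrite big_nil; case: ifP => _; first exact: explore_cost_ge0.
  by apply: arm_cost_ge0 => // ys; exact: explore_cost_ge0.
(* As [m] is positive, the default value of [emp] is not met, and multiplying by [m] turns the test
   on the empirical mean into a sign test. *)
have keepE : (1 - 2 * dl <= emp s (sg_cur s)) = (0 <= w).
  rewrite /emp cur cnt wE /th -[in RHS]cnt cnt.
  case: m m0 {nT cnt wE} => // m _.
  by rewrite ler_pdivlMr// subr_ge0 mulrC.
have TmE : (T - m = (T - m.+1).+1)%N by lia.
rewrite /= /sg_choose keepE.
case: (leP 0 w) => w0.
  rewrite big_cons cur TmE /= lerD2l.
  rewrite -nth0 nth_drop addn0 -drop1 !drop_drop.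
  set s' := sg_update _ _ _ _.
  have E : sg_sum s' i - m.+1%:R * th = w + (nth 0 xs (i * T + m) - th).
    by rewrite /s' /= eqxx cnt /tape wE mulrS; ring.
  have -> : (T - m.+1 + 1 + (i * T + m) = i.+1 * T)%N by rewrite mulSn; lia.
  have -> : (1 + (i * T + m) = i * T + m.+1)%N by rewrite add1n addnS.
  apply: (IH s' i m.+1) => //=; first by rewrite addnS -addSn.
  - by rewrite eqxx cnt.
  by move=> j ij /=; rewrite gtn_eqF//; exact: fresh.
(* Arm [i] is abandoned. The first pull of the next arm is made without a test, so the invariant
   resumes with one pull on arm [i.+1]. *)
rewrite cur; case: ltnP => ik1.
  rewrite big_cons (drop_nth 0 ik1) /=.
  have T0 : (T = T.-1.+1)%N by lia.
  rewrite [X in arm_cost _ _ _ X]T0 /= lerD2l add0r.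
  rewrite -nth0 nth_drop addn0 -drop1 !drop_drop.
  set s' := sg_update _ _ _ _.
  have [c0 s0] := fresh i.+1 (ltnSn i).
  have E : sg_sum s' i.+1 - 1%:R * th = nth 0 xs (i.+1 * T) - th.
    by rewrite /s' /= eqxx c0 s0 /tape addn0 add0r mul1r.
  have -> : (T.-1 + 1 + i.+1 * T = i.+2 * T)%N by rewrite mulSn; lia.
  have -> : T.-1 = (T - 1)%N by rewrite subn1.
  rewrite [(1 + _)%N]addnC.

  apply: (IH s' i.+1 1%N) => //=.
  - by rewrite addn1; lia.
  - by rewrite eqxx c0.
  by move=> j ij /=; rewrite gtn_eqF//; apply: fresh; exact: ltnW.
(* No arm is left: the pulls still to come cost at most 1 each and number at most [T]. *)
rewrite drop_oversize//=.
apply: (@le_trans _ _ (\sum_(a <- emp_argmax (size mus) s ::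
   sg_run (2 * dl) (size mus) (tape T xs) n false
     (sg_update (tape T xs) i (emp_argmax (size mus) s) s)) 1)).
  exact: ler_sum.
rewrite big_const_seq count_predT /= size_sg_run iter_addr_0.
by rewrite -mulrS ler_nat; lia.
Qed.

Lemma realized_regret_le dl T mus xs : 0 <= dl -> (0 < T)%N -> mus != [::] ->
  all (fun mu => 0 <= mu <= 1) mus ->
  realized_regret (2 * dl) T (size mus) mus xs <=
  3 * dl * T%:R + explore_cost dl T mus xs.
Proof.
move=> dl0 T0 mus0 mus01.
pose D i := big_gap dl (nth 0 mus i).
have mus_ge0 : all (fun mu => 0 <= mu) mus.
  by apply: sub_all mus01 => x /andP[].
rewrite /realized_regret /seq_greedy_actions; set acts := sg_run _ _ _ _ _ _.
have szT : size acts = T by exact: size_sg_run.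
have maxle : \big[Num.max/nth 0 mus 0]_(i < size mus) nth 0 mus i <= 1.
  have le1 i : (i < size mus)%N -> nth 0 mus i <= 1.
    by move=> ik; have /(all_nthP 0)/(_ i ik)/andP[] := mus01.
  apply: (big_ind (fun x => x <= 1)) => [|x y x1 y1|i _]; last exact: le1.
  - by apply: le1; rewrite lt0n size_eq0.
  - by rewrite ge_max x1.
(* The best mean is replaced by 1, so that each arm is charged for its own gap only. *)
apply: (@le_trans _ _ (\sum_(a <- acts) (1 - nth 0 mus a))).
  rewrite big_split /= sumrN lerD2r big_const_seq count_predT szT iter_addr_0.
  by rewrite -mulr_natl mulr1 ler_piMr.
apply: (@le_trans _ _ (\sum_(a <- acts) (3 * dl + D a))).
  by apply: ler_sum => a _; exact: gap_le_big_gap.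
rewrite big_split /= big_const_seq count_predT szT iter_addr_0 -(mulr_natr (3 * dl)) lerD2l.
case: mus mus0 {maxle} mus01 mus_ge0 @D @acts szT => // mu mus _ _ mus_ge0 D acts szT.
case: T T0 @acts szT => // T _ acts szT.
(* The horizon is now [T.+1]: the first pull is forced, and the invariant starts at arm 0 with one
   pull made and [T] to go. *)
have := @sg_run_cost_le dl T.+1 (mu :: mus) xs T
  (sg_update (tape T.+1 xs) 0 0 (sg_init R)) 0 1 dl0 mus_ge0.
rewrite addn1 => /(_ (leqnn _) isT isT erefl) /=.
move=> /(_ erefl) H.
rewrite /acts /= big_cons /= lerD2l.
have {}H := H _ _ erefl; move: H.
rewrite /tape mul0n addn0 mul1n mul1r !add0r subn1 /= drop0 -drop1 drop_drop (addn1 T) -nth0.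
by apply; case.
Qed.

End Pathwise.

(** * Iterated integrals over lists of probability measures *)

Section IteratedIntegral.
Variable R : realType.
Local Open Scope ereal_scope.
Implicit Types (ps qs : seq (probability R R)) (f g : seq R -> \bar R).

Lemma iint_ge0 ps f : (forall xs, 0 <= f xs) -> 0 <= iint ps f.
Proof.
elim: ps f => [|p ps IH] f f0 /=; first exact: f0.
by apply: integral_ge0 => x _; exact: IH.
Qed.

Lemma le_iint ps f g : (forall xs, 0 <= g xs) -> (forall xs, f xs <= g xs) ->
  iint ps f <= iint ps g.
Proof.
elim: ps f g => [|p ps IH] f g g0 fg /=; first exact: fg.
by apply: le_integral_nomeas => x; [exact: iint_ge0|exact: IH].
Qed.

(** Lets pointwise bounds assume that all the means lie in [0, 1], a set of full prior measure. *)
Lemma le_iint_nseq_on (A : set R) (p : probability R R) n f g :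
  measurable A -> p (~` A)%classic = 0 -> (forall xs, 0 <= g xs) ->
  (forall xs, size xs = n -> (forall x, x \in xs -> A x) -> f xs <= g xs) ->
  iint (nseq n p) f <= iint (nseq n p) g.
Proof.
move=> mA pA; elim: n f g => [|n IH] f g g0 fg /=; first exact: fg.
apply: (le_integral_ae mA pA) => [x|x Ax]; first exact: iint_ge0.
apply: IH => // xs szxs xsA; apply: fg => [/=|y]; first by rewrite szxs.
by rewrite inE => /predU1P[->//|]; exact: xsA.
Qed.

Lemma iint_cst ps (c : \bar R) : iint ps (fun=> c) = c.
Proof. by elim: ps => //= p ps ->; exact: integral_prob_cst. Qed.

Lemma iint_addl ps (c : R) f : (0 <= c)%R -> (forall xs, 0 <= f xs) ->
  iint ps (fun xs => c%:E + f xs) <= c%:E + iint ps f.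
Proof.
move=> c0; elim: ps f => [|p ps IH] f f0 //=.
apply: (@le_trans _ _ (\int[p]_x (c%:E + iint ps (fun xs => f (x :: xs))))).
  by apply: le_integral_nomeas => x; [rewrite adde_ge0 ?lee_fin ?iint_ge0|exact: IH].
by apply: integral_prob_addl => // x; exact: iint_ge0.
Qed.

Lemma iintZ ps (a : R) f : (0 <= a)%R -> (forall xs, 0 <= f xs) ->
  iint ps (fun xs => a%:E * f xs) = a%:E * iint ps f.
Proof.
move=> a0; elim: ps f => [|p ps IH] f f0 //=.
rewrite -integralZ_nomeas//; last by move=> x; exact: iint_ge0.
by apply: eq_integral => x _; exact: IH.
Qed.

(** The rewards of an abandoned arm that are never read integrate out. *)
Lemma iint_drop (p : probability R R) n qs f :
  iint (nseq n p ++ qs) (f \o drop n) = iint qs f.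
Proof.
elim: n => [|n IH] /=; last by rewrite -[RHS](integral_prob_cst p) -IH.
by congr iint; apply/funext => xs /=; rewrite drop0.
Qed.

End IteratedIntegral.

(** * Expected cost of one arm: supersolutions and exponential supermartingales *)

Section ArmValue.
Variable R : realType.
Local Open Scope ereal_scope.
Implicit Types (p : probability R R) (c th h s w : R).

(* Expected [arm_cost] when the continuation has expected cost [h]. *)
Fixpoint arm_value p c th h n w : \bar R :=
  match n with
  | 0%N => 0
  | n'.+1 => c%:E + \int[p]_x (let w' := (w + (x - th))%R in
                              if (w' < 0)%R then h%:E else arm_value p c th h n' w')
  end.

Lemma arm_value_ge0 p c th h n w : (0 <= c)%R -> (0 <= h)%R ->
  0 <= arm_value p c th h n w.
Proof.
move=> c0 h0; elim: n w => //= n IH w; rewrite adde_ge0 ?lee_fin//.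
by apply: integral_ge0 => x _ /=; case: ifP.
Qed.

Lemma iint_arm_cost p qs c th h (cont : seq R -> R) n w :
  (0 <= c)%R -> (0 <= h)%R -> (forall ys, 0 <= cont ys)%R ->
  iint qs (EFin \o cont) <= h%:E ->
  iint (nseq n p ++ qs) (fun xs => (arm_cost c th cont n w xs)%:E) <=
  arm_value p c th h n w.
Proof.
move=> c0 h0 cont0 conth; elim: n w => [|n IH] w /=; first by rewrite iint_cst.
apply: le_trans; last apply: integral_prob_addl => //; last first.
  by move=> x; case: ifP => // _; exact: arm_value_ge0.
apply: le_integral_nomeas => x /=.
  by rewrite adde_ge0//; case: ifP => // _; exact: arm_value_ge0.
case: ifP => _.
  apply: le_trans (leeD2l c%:E conth); rewrite -(iint_drop p n qs (EFin \o cont)).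
  by apply: (@iint_addl _ _ c (fun xs => (cont (drop n xs))%:E)) => // xs; rewrite lee_fin.
apply: le_trans (leeD2l c%:E (IH _)).
by apply: iint_addl => // xs; rewrite lee_fin arm_cost_ge0.
Qed.

(** Dynamic programming comparison: [u] is a supersolution of the recursion, so one induction bounds
    all horizons at once. Below, [u] is built from an exponential of [w]. *)
Lemma arm_value_le_super p c th h (u : R -> R) :
  (forall w, 0 <= w -> 0 <= u w)%R ->
  (forall w, (0 <= w)%R -> c%:E +
    \int[p]_x (if (w + (x - th) < 0)%R then h%:E else (u (w + (x - th)))%:E) <= (u w)%:E) ->
  (0 <= h)%R -> forall n w, (0 <= w)%R -> arm_value p c th h n w <= (u w)%:E.
Proof.
move=> u0 sup h0; elim=> [|n IH] w w0 /=; first by rewrite lee_fin u0.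
apply: le_trans (sup w w0); rewrite leeD2l//; apply: le_integral_nomeas => x.
  by case: ltP => // w'0; rewrite lee_fin ?u0.
by case: ltP => // w'0; exact: IH.
Qed.

Lemma arm_value_le p th h n w : (0 <= h)%R -> arm_value p 0 th h n w <= h%:E.
Proof.
move=> h0; elim: n w => [|n IH] w /=; first by rewrite lee_fin.
by rewrite add0e; apply: integral_prob_le => // x; case: ifP.
Qed.

(** The supersolution is [h + K e^(s w)] with [K = c / (1 - rho)]. A pull multiplies the expected
    exponential by at most [rho], and the decrease [K (1 - rho) e^(s w)] pays for [c] because
    [w >= 0]. *)
Lemma arm_value_downward p c th h s rho n : (0 <= c)%R -> (0 <= h)%R ->
  (0 <= s)%R -> (0 <= rho < 1)%R ->
  \int[p]_x (expR (s * (x - th)))%:E <= rho%:E ->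
  arm_value p c th h n 0 <= (h + c / (1 - rho))%:E.
Proof.
move=> c0 h0 s0 /andP[rho0 rho1] mom.
have K0 : (0 <= c / (1 - rho))%R by rewrite divr_ge0// subr_ge0 ltW.
have := @arm_value_le_super p c th h
  (fun w => h + c / (1 - rho) * expR (s * w))%R _ _ h0 n 0%R (lexx _).
rewrite mulr0 expR0 mulr1; apply.
  by move=> w _; rewrite addr_ge0// mulr_ge0//.
move=> w w0.
have cE : c = (c / (1 - rho) * (1 - rho))%R by rewrite divfK// subr_eq0 gt_eqF.
set K := (c / (1 - rho))%R in K0 cE *; clearbody K.
apply: (@le_trans _ _ (c%:E + (h%:E +
    (K * expR (s * w))%:E * \int[p]_x (expR (s * (x - th)))%:E))).
  rewrite leeD2l// -integralZ_nomeas; last 2 first.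
  - by rewrite mulr_ge0//.
  - by move=> x; rewrite lee_fin expR_ge0.
  apply: (@le_trans _ _ (\int[p]_x (h%:E +
      (K * expR (s * w))%:E * (expR (s * (x - th)))%:E))); last first.
    apply: integral_prob_addl => // x.
    by rewrite -EFinM lee_fin mulr_ge0// mulr_ge0//.
  apply: le_integral_nomeas => x.
    by rewrite -EFinM -EFinD lee_fin addr_ge0// mulr_ge0// mulr_ge0//.
  rewrite -EFinM -EFinD -mulrA -expRD -mulrDr; case: ifP => // _.
  by rewrite lee_fin lerDl mulr_ge0//.
have Ke0 : (0 <= K * expR (s * w))%R by rewrite mulr_ge0//.
apply: (@le_trans _ _ (c%:E + (h%:E + (K * expR (s * w))%:E * rho%:E))).
  by rewrite !leeD2l// lee_wpmul2l.
rewrite -EFinM -!EFinD lee_fin.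
have e1 : (1 <= expR (s * w))%R by rewrite -expR0 ler_expR mulr_ge0.
have : (0 <= K * (1 - rho) * (expR (s * w) - 1))%R.
  by rewrite mulr_ge0 ?subr_ge0// -cE.
rewrite cE; lra.
Qed.

(** With zero pull cost only ruin is charged. The supermartingale [e^(- s w)] exceeds 1 at ruin, so
    ruin from height [w] has probability at most [e^(- s w)]. *)
Lemma arm_value_upward p th h s n w : (0 <= h)%R -> (0 <= s)%R -> (0 <= w)%R ->
  \int[p]_x (expR (- s * (x - th)))%:E <= 1 ->
  arm_value p 0 th h n w <= (h * expR (- s * w))%:E.
Proof.
move=> h0 s0 w0 mom.
apply: (@arm_value_le_super p 0 th h (fun w => h * expR (- s * w))%R) => //.
  by move=> v _; rewrite mulr_ge0//.
move=> v v0; rewrite add0e.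
have he0 : (0 <= h * expR (- s * v))%R by rewrite mulr_ge0//.
apply: (@le_trans _ _ ((h * expR (- s * v))%:E * \int[p]_x (expR (- s * (x - th)))%:E)).
  rewrite -integralZ_nomeas; [|done|by move=> x; rewrite lee_fin expR_ge0].
  apply: le_integral_nomeas => x; first by rewrite -EFinM lee_fin mulr_ge0//.
  rewrite -EFinM -mulrA -expRD -mulrDr; case: ltP => // w'0.
  rewrite lee_fin ler_peMr// -expR0 ler_expR mulNr oppr_ge0 mulr_ge0_le0//.
  exact: ltW.
by rewrite -[leRHS]mule1 lee_wpmul2l.
Qed.

Lemma subgaussian1_shift p mu th s : subgaussian1 p mu ->
  \int[p]_x (expR (s * (x - th)))%:E <= (expR (s ^+ 2 / 2 + s * (mu - th)))%:E.
Proof.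
move=> sg; rewrite expRD mulrC EFinM.
have e0 := expR_ge0 (s * (mu - th)).
apply: le_trans (lee_wpmul2l _ (sg s)); last by rewrite lee_fin.
rewrite -integralZ_nomeas//.
apply: le_integral_nomeas => x; rewrite -EFinM lee_fin; first by rewrite mulr_ge0//.
by rewrite -expRD le_eqVlt; apply/orP; left; apply/eqP; congr expR; ring.
Qed.

(** For [s <= 2 dl] the subgaussian term [s^2 / 2] is absorbed by the drift term [s dl]. *)
Lemma subgaussian1_drift p mu th dl s : subgaussian1 p mu ->
  (0 <= s <= 2 * dl)%R -> (th + dl <= mu)%R ->
  \int[p]_x (expR (- s * (x - th)))%:E <= 1.
Proof.
move=> sg /andP[s0 sdl] thmu; apply: le_trans (subgaussian1_shift _ _ sg) _.
rewrite lee_fin expR_le1; nra.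
Qed.

End ArmValue.

(** * Probability of keeping a good arm for ever: general and Bernoulli rewards *)

Section KeepProbability.
Variable R : realType.
Local Open Scope ereal_scope.
Implicit Types (p : probability R R) (mu th dl h s w : R).
Import HBNNSimple.

Lemma expRN_le_inv (x : R) : (0 <= x)%R -> (expR (- x) <= (1 + x)^-1)%R.
Proof.
move=> x0; rewrite expRN lef_pV2 ?posrE ?expR_gt0 ?expR_ge1Dx//.
by rewrite ltr_wpDr.
Qed.

Lemma expRN_le_half (x : R) : (0 <= x <= 1)%R -> (expR (- x) <= 1 - x / 2)%R.
Proof.
move=> /andP[x0 x1]; apply: le_trans (expRN_le_inv x0) _.
by rewrite -[leLHS]mul1r ler_pdivrMr ?ltr_wpDr//; nra.
Qed.

Lemma expR_half_le2 : (expR (1 / 2) <= 2 :> R)%R.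
Proof.
have := expR_ge1Dx (- (1 / 2) : R)%R; rewrite expRN.
have := expR_gt0 (1 / 2 : R)%R; move: (expR _) => e e0.
rewrite -[X in (_ <= X)%R]mul1r ler_pdivlMr//; lra.
Qed.

Lemma arm_value_step_upward p th h s n x : (0 <= h)%R -> (0 <= s)%R ->
  \int[p]_x (expR (- s * (x - th)))%:E <= 1 ->
  (if (0 + (x - th) < 0)%R then h%:E else arm_value p 0 th h n (0 + (x - th))) <=
  (if (x < th)%R then h%:E else (h * expR (- s * (x - th)))%:E).
Proof.
move=> h0 s0 mom; rewrite add0r subr_lt0; case: ltP => // thx.
by apply: arm_value_upward => //; rewrite subr_ge0.
Qed.

(** The choice [s = dl] minimises [s^2 / 2 - s dl]. The expected exponential after the first pull is
    then at most [e^(- dl^2 / 2)], hence at most [1 - dl^2 / 4]. *)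
Lemma keep_general p mu th dl h n : subgaussian1 p mu -> (0 <= dl <= 1)%R ->
  (th + dl <= mu)%R -> (0 <= h)%R ->
  arm_value p 0 th h n 0 <= ((1 - dl ^+ 2 / 4) * h)%:E.
Proof.
move=> sg /andP[dl0 dl1] thmu h0.
have r0 : (0 <= (1 - dl ^+ 2 / 4) * h)%R by rewrite mulr_ge0//; nra.
case: n => [|n] /=; first by rewrite lee_fin.
have mom : \int[p]_x (expR (- dl * (x - th)))%:E <= 1.
  by apply: (subgaussian1_drift sg _ thmu); lra.
rewrite add0e; apply: (@le_trans _ _ (h%:E * \int[p]_x (expR (- dl * (x - th)))%:E)).
  rewrite -integralZ_nomeas//; apply: le_integral_nomeas => x.
    by rewrite -EFinM lee_fin mulr_ge0.
  apply: le_trans (arm_value_step_upward n x h0 dl0 mom) _.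
  case: ltP => [xth|_]; last by rewrite EFinM.
  by rewrite -EFinM lee_fin ler_peMr// -expR0 ler_expR mulNr -mulrN mulr_ge0//; lra.
apply: (@le_trans _ _ (h%:E * (expR (- (dl ^+ 2 / 2)))%:E)).
  rewrite lee_wpmul2l//; apply: le_trans (subgaussian1_shift _ _ sg) _.
  by rewrite lee_fin ler_expR; nra.
rewrite -EFinM lee_fin mulrC ler_wpM2r//.
apply: le_trans (expRN_le_half _) _; nra.
Qed.

Lemma bernoulli_integral_le p mu (f : R -> \bar R) : (0 <= mu <= 1)%R ->
  (forall A, measurable A -> p A = (mu%:E * \d_(1%R : R) A + (1 - mu)%R%:E * \d_(0%R : R) A)) ->
  (forall x, 0 <= f x) -> \int[p]_x f x <= mu%:E * f 1%R + (1 - mu)%:E * f 0%R.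
Proof.
move=> /andP[mu0 mu1] pE f0.
have mu1' : (0 <= 1 - mu)%R by rewrite subr_ge0.
apply: integral_le_sintegral => // k kf.
rewrite -integralT_nnsfun.
pose q := measure_add (mscale (NngNum mu0) \d_(1%R : R))
                      (mscale (NngNum mu1') \d_(0%R : R)).
rewrite (@eq_measure_integral _ _ _ _ q); last first.
  by move=> A mA _; rewrite [RHS]measure_addE; exact: pE.
have mk : measurable_fun setT (fun x => (k x)%:E) by exact/measurable_EFinP.
have k0 x : 0 <= (k x)%:E by rewrite lee_fin fun_ge0.
rewrite ge0_integral_measure_add// !ge0_integral_mscale// !integral_dirac//.
rewrite !diracT !mul1e.
by apply: leeD; rewrite lee_wpmul2l.
Qed.

(** Failures have probability at most [dl], so the rate [s = 1/2], independent of [dl], already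
    gives a supermartingale. It remains to reach a constant height, which a run of about
    [1 / (2 dl)] successes does. *)
Lemma keep_bernoulli p mu dl h n :
  (forall A, measurable A -> p A = (mu%:E * \d_(1%R : R) A + (1 - mu)%R%:E * \d_(0%R : R) A)) ->
  (0 < dl <= 1 / 4)%R -> (1 - dl <= mu <= 1)%R -> (0 <= h)%R ->
  arm_value p 0 (1 - 2 * dl) h n 0 <= ((1 - 1 / 10) * h)%:E.
Proof.
move=> pE /andP[dl0 dl4] /andP[mudl mu1] h0.
have mu01 : (0 <= mu <= 1)%R by apply/andP; split; lra.
pose g w : R := (1 - expR (- (1 / 2) * w))%R.
have g0 w : (0 <= w)%R -> (0 <= g w <= 1)%R.
  by move=> w0; rewrite /g subr_ge0 gerBl expR_ge0 andbT expR_le1; lra.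
(* Since [e^(1/2) <= 2], the moment is at most [(1 + dl) e^(- dl) <= 1]. *)
have mom : \int[p]_x (expR (- (1 / 2) * (x - (1 - 2 * dl))))%:E <= 1.
  apply: le_trans (bernoulli_integral_le mu01 pE _) _ => [x|].
    by rewrite lee_fin expR_ge0.
  rewrite -!EFinM -EFinD lee_fin.
  have -> : (- (1 / 2) * (1 - (1 - 2 * dl)) = - dl)%R by lra.
  have -> : (- (1 / 2) * (0 - (1 - 2 * dl)) = 1 / 2 - dl)%R by lra.
  rewrite expRD; set e := expR (- dl)%R; set e2 := expR _.
  have e2_le : (e2 <= 2)%R by exact: expR_half_le2.
  have e0 : (0 <= e)%R by exact: expR_ge0.
  have ee : (e * (1 + dl) <= 1)%R.
    rewrite -ler_pdivlMr ?div1r; first exact: expRN_le_inv (ltW dl0).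
    by rewrite ltr_wpDr// ltW.
  have : (mu + (1 - mu) * e2 <= 1 + dl)%R by nra.
  move/(ler_wpM2l e0); lra.
(* The first [m] pulls may all pay 1, each lifting the sum by [2 * dl]. *)
have climb m : forall n w, (0 <= w)%R -> arm_value p 0 (1 - 2 * dl) h n w <=
    (h * (1 - (1 - dl) ^+ m * g (w + 2 * dl * m%:R)))%:E.
  elim: m => [|m IH] {}n w w0.
    rewrite expr0 mul1r mulr0 addr0 /g subKr.
    by apply: arm_value_upward => //; lra.
  have gm := g0 (w + 2 * dl * m.+1%:R)%R.
  have w'0 : (0 <= w + 2 * dl * m.+1%:R)%R by rewrite addr_ge0// mulr_ge0//; lra.
  have [gm0 gm1] := andP (gm w'0).
  have em : (0 <= (1 - dl) ^+ m <= 1)%R.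
    by rewrite exprn_ge0 ?exprn_ile1//; lra.
  have [em0 em1] := andP em.
  set G := g _ in gm0 gm1 *; set E := ((1 - dl) ^+ m)%R in IH em0 em1 *.
  have EG : (0 <= E * G <= 1)%R by apply/andP; split; nra.
  have [EG0 EG1] := andP EG.
  have B0 : (0 <= h * (1 - (1 - dl) * (E * G)))%R by rewrite mulr_ge0//; nra.
  rewrite exprS -/E -mulrA.
  case: n => [|n] /=; first by rewrite lee_fin.
  rewrite add0e; apply: le_trans (bernoulli_integral_le mu01 pE _) _.
    by move=> x; case: ifP => _; rewrite ?lee_fin//; exact: arm_value_ge0.
  apply: (@le_trans _ _ (mu%:E * (h * (1 - E * G))%:E + (1 - mu)%:E * h%:E)).
    have [? ?] := andP mu01.
    apply: leeD; rewrite lee_wpmul2l ?lee_fin ?subr_ge0//; last first.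
      by case: ifP => // _; exact: arm_value_le.
    rewrite ifF; last by apply/negbTE; rewrite -leNgt; lra.
    have -> : (w + (1 - (1 - 2 * dl)) = w + 2 * dl)%R by lra.
    apply: le_trans (IH _ _ _) _; first by lra.
    have -> : (w + 2 * dl + 2 * dl * m%:R = w + 2 * dl * m.+1%:R)%R.
      by rewrite -natr1; lra.
    by [].
  rewrite -!EFinM -EFinD lee_fin.
  have : (0 <= h * ((mu - (1 - dl)) * (E * G)))%R by rewrite !mulr_ge0// subr_ge0.
  lra.
(* Then [m dl] lies in [1/4, 1/2]. By Bernoulli's inequality [m] successes in a row have probability
   at least 1/2; they reach height at least 1/2, where survival has probability at least
   [1 - e^(-1/4) >= 1/5]. The product is 1/10. *)
pose m := Num.truncn (1 / (2 * dl)).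
have m_le : (m%:R * dl <= 1 / 2)%R.
  have : (m%:R <= 1 / (2 * dl))%R by rewrite truncn_le// divr_ge0//; lra.
  by rewrite ler_pdivlMr; lra.
have m_ge : (1 / 4 <= m%:R * dl)%R.
  have : (1 / (2 * dl) < m.+1%:R)%R by exact: truncnS_gt.
  by rewrite ltr_pdivrMr -?(natr1 m); lra.
apply: le_trans (climb m n 0%R (lexx _)) _; rewrite lee_fin mulrC ler_wpM2r//.
rewrite lerD2l lerN2 add0r.
have pow_ge : (1 / 2 <= (1 - dl) ^+ m)%R.
  have : (1 - m%:R * dl <= (1 - dl) ^+ m)%R.
    elim: (m) => [|j IH]; first by rewrite expr0; lra.
    have d1 : (0 <= 1 - dl)%R by lra.
    have := ler_wpM2l d1 IH; rewrite -exprS; apply: le_trans.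
    have : (0 <= j%:R * dl * dl)%R by rewrite !mulr_ge0// ltW.
    rewrite -(natr1 j); lra.
  lra.
have g_ge : (1 / 5 <= g (2 * dl * m%:R))%R.
  have : (expR (- (1 / 4)) <= (1 + 1 / 4)^-1 :> R)%R by apply: expRN_le_inv; lra.
  have : (expR (- (1 / 2) * (2 * dl * m%:R)) <= expR (- (1 / 4)))%R.
    by rewrite ler_expR; lra.
  have -> : ((1 + 1 / 4)^-1 = 4 / 5 :> R)%R by field.
  rewrite /g; lra.
have g1 : (0 <= g (2 * dl * m%:R))%R by lra.
apply: le_trans (ler_wpM2r g1 pow_ge); lra.
Qed.

(** Let [y] be the positive part of the first increment and [a = 2 dl y]. Ruin has conditional
    probability at most [e^(- a) <= 1 - a + a^2], while [E y >= p0] and [E y^2 <= 16]. This gives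
    [1 - 2 p0 dl + 64 dl^2], and [64 dl <= p0] absorbs the square. *)
Lemma keep_positive_part p mu th dl (p0 : R) h n : subgaussian1 p mu ->
  (0 <= 64 * dl <= p0)%R -> (dl <= 1 / 4)%R -> (th + dl <= mu)%R -> (mu <= th + 2 * dl)%R ->
  p0%:E <= \int[p]_x ((x - th) * ((th <= x)%R)%:R)%R%:E -> (0 <= h)%R ->
  (p0 * dl <= 1)%R ->
  arm_value p 0 th h n 0 <= ((1 - p0 * dl) * h)%:E.
Proof.
move=> sg /andP[dl0 dlp0] dl4 thmu muth p0_le h0 p0dl.
have r0 : (0 <= (1 - p0 * dl) * h)%R by rewrite mulr_ge0// subr_ge0.
case: n => [|n] /=; first by rewrite lee_fin.
have s0 : (0 <= 2 * dl)%R by lra.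
have mom : \int[p]_x (expR (- (2 * dl) * (x - th)))%:E <= 1.
  by apply: (subgaussian1_drift sg _ thmu); lra.
rewrite add0e.
set F := fun x : R => _.
have F0 x : 0 <= F x by rewrite /F; case: ifP => // _; exact: arm_value_ge0.
set P := fun x : R => _ in p0_le.
have P0 x : 0 <= P x.
  by rewrite /P lee_fin; case: (leP th x) => thx; rewrite ?mulr0// mulr1 subr_ge0.
have hs0 : (0 <= h * (2 * dl))%R by rewrite mulr_ge0.
have hs2 : (0 <= h * (2 * dl) ^+ 2 * 4)%R by rewrite 2?mulr_ge0// sqr_ge0.
have E4 : \int[p]_x (expR (1 * (x - th)))%:E <= 4%:E.
  apply: le_trans (subgaussian1_shift _ _ sg) _; rewrite lee_fin.
  apply: (@le_trans _ _ (expR (1 / 2 + 1 / 2)%R)); first by rewrite ler_expR expr1n; lra.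
  rewrite expRD; have := expR_half_le2; have := expR_ge0 (1 / 2 : R)%R.
  move: (expR _) => e e0 e2; nra.
(* The negative linear term is moved to the left, where superadditivity of the lower integral
   applies. *)
suff H : \int[p]_x F x + (h * (2 * dl))%:E * p0%:E <=
    h%:E + (h * (2 * dl) ^+ 2 * 4)%:E * 4%:E.
  rewrite -EFinM -leeBrDr// in H; apply: le_trans H _.
  rewrite -!EFinM -!EFinD lee_fin.
  have : (0 <= h * (dl * (p0 - 64 * dl)))%R by apply: mulr_ge0 => //; apply: mulr_ge0 => //; lra.
  lra.
apply: (@le_trans _ _ (\int[p]_x F x + (h * (2 * dl))%:E * \int[p]_x P x)).
  by rewrite leeD2l// lee_wpmul2l.
apply: (@le_trans _ _ (h%:E + (h * (2 * dl) ^+ 2 * 4)%:E *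
    \int[p]_x (expR (1 * (x - th)))%:E)); last by rewrite leeD2l// lee_wpmul2l.
rewrite -!integralZ_nomeas//.
apply: le_trans (le_integralD_nomeas _ _ _) _ => //.
  by move=> x; rewrite mule_ge0.
apply: le_trans; last apply: integral_prob_addl => //; last first.
  by move=> x; rewrite mule_ge0.
apply: le_integral_nomeas => x.
  by rewrite adde_ge0// mule_ge0.
apply: le_trans (leeD2r _ (arm_value_step_upward n x h0 s0 mom)) _.
rewrite /P mul1r; case: ltP => [xth|thx].
  by rewrite mulr0 mule0 leeD2l// mule_ge0//.
rewrite mulr1 -!EFinM -!EFinD lee_fin.
set y := (x - th)%R; have y0 : (0 <= y)%R by rewrite subr_ge0.
(* Squaring [1 + y / 2 <= e^(y / 2)] gives this bound. *)
have ey : (y ^+ 2 <= 4 * expR y)%R.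
  have -> : y = (y / 2 + y / 2)%R by lra.
  rewrite [in leRHS]expRD; have := expR_ge1Dx (y / 2)%R.
  have := expR_ge0 (y / 2)%R; nra.
have sy0 : (0 <= 2 * dl * y)%R by rewrite mulr_ge0.
(* Uses [e^(- a) <= 1 / (1 + a)] and [(1 - a + a^2) (1 + a) = 1 + a^3]. *)
have es : (expR (- (2 * dl) * y) <= 1 - 2 * dl * y + (2 * dl * y) ^+ 2)%R.
  rewrite mulNr; apply: le_trans (expRN_le_inv sy0) _.
  rewrite -[leLHS]mul1r ler_pdivrMr ?ltr_wpDr//.
  have : (0 <= (2 * dl * y) ^+ 3)%R by rewrite exprn_ge0.
  lra.
have := ler_wpM2l h0 es.
have hd : (0 <= h * (2 * dl) ^+ 2)%R by rewrite mulr_ge0// sqr_ge0.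
have := ler_wpM2l hd ey.
lra.
Qed.

End KeepProbability.

(** * Keeping a good arm under upward-looking rewards *)

Section UpwardLooking.
Variable R : realType.
Local Open Scope ereal_scope.
Implicit Types (p : probability R R) (mu th dl h s w : R) (ys : seq R).

(* Recursive form of [hit_up_at th n.+1] for a walk started at [w]. *)
Fixpoint exits_above th w n ys : bool :=
  let w' := (w + (head 0 ys - th))%R in
  if n is n'.+1 then [&& 0 <= w', w' < 1 & exits_above th w' n' (behead ys)]%R
  else (1 <= w')%R.

Lemma walkS th ys m : walk th ys m.+1 = ((head 0 ys - th) + walk th (behead ys) m)%R.
Proof.
rewrite /walk big_ord_recl -nth0 -[m.+1%:R]natr1.
under [in RHS]eq_bigr do rewrite nth_behead.
rewrite /= (_ : \sum_(i < m) nth 0%R ys (lift ord0 i) = \sum_(i < m) nth 0%R ys i.+1)%R.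
  by ring.
by apply: eq_bigr.
Qed.

Lemma hit_up_at_exits_above th n ys :
  hit_up_at th n.+1 ys -> exits_above th 0 n ys.
Proof.
move=> /andP[/forallP stay top].
suff: forall w, (1 <= w + walk th ys n.+1)%R ->
    (forall m, (0 < m < n.+1)%N -> 0 <= w + walk th ys m < 1)%R ->
    exits_above th w n ys.
  apply; first by rewrite add0r.
  by move=> m /andP[m0 mn]; have := stay (Ordinal mn); rewrite /= m0 add0r.
move=> w {stay top}.
elim: n w ys => [|n IH] w ys top stay /=.
  by move: top; rewrite walkS /walk big_ord0 mul0r subrr addr0.
have := stay 1%N isT; rewrite walkS /walk big_ord0 mul0r subrr addr0.
move=> /andP[-> ->] /=; apply: IH; first by move: top; rewrite walkS addrA.
move=> m /andP[m0 mn]; have := stay m.+1; rewrite walkS addrA; apply.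
by rewrite ltnS.
Qed.

Lemma le_integral_sum_nomeas p (F : nat -> R -> \bar R) N :
  (forall l x, 0 <= F l x) ->
  \sum_(l < N) \int[p]_x F l x <= \int[p]_x (\sum_(l < N) F l x).
Proof.
move=> F0; elim: N => [|N IH].
  by rewrite big_ord0 integral_ge0// => x _; rewrite big_ord0.
rewrite big_ord_recr /=.
apply: le_trans (leeD2r _ IH) _.
apply: le_trans (le_integralD_nomeas _ _ _) _ => //.
  by move=> x; exact: sume_ge0.
apply: le_integral_nomeas => x; rewrite big_ord_recr//= adde_ge0//.
exact: sume_ge0.
Qed.

(** A truncation of the series [hit_up_prob], with arbitrary start [w], so that induction on [N] is
    possible. *)
Definition exit_above_prob p th N w : \bar R :=
  \sum_(l < N) iint (nseq l.+1 p) (fun ys => (exits_above th w l ys)%:R%R%:E).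

(** First-step analysis. It is an inequality because sums and lower integrals are exchanged by
    superadditivity; the summand [l = 0] is an exit at the first step. *)
Lemma exit_above_prob_step p th N w :
  exit_above_prob p th N.+1 w <=
  \int[p]_x (let w' := (w + (x - th))%R in
    if (w' < 0)%R then 0 else if (1 <= w')%R then 1 else exit_above_prob p th N w').
Proof.
rewrite /exit_above_prob.
apply: le_trans (@le_integral_sum_nomeas p (fun l x => iint (nseq l p)
  (fun ys => (exits_above th w l (x :: ys))%:R%R%:E)) N.+1 _) _.
  by move=> l x; apply: iint_ge0 => ys; rewrite lee_fin.
apply: le_integral_nomeas => x /=.
  case: ifP => // _; case: ifP => // _; apply: sume_ge0 => l _.
  by apply: integral_ge0 => y _; apply: iint_ge0 => ys; rewrite lee_fin.
rewrite big_ord_recl /=; case: (ltP (w + (x - th))%R 0%R) => w0.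
  rewrite [(1 <= _)%R]leNgt (lt_trans w0 ltr01) /= add0e big1// => l _.
  by rewrite -[RHS](integral_prob_cst p); apply: eq_integral => y _; rewrite iint_cst.
case: (leP 1%R (w + (x - th))%R) => w1 /=.
  rewrite big1 ?adde0// => l _.
  by rewrite -[RHS](integral_prob_cst p); apply: eq_integral => y _; rewrite iint_cst.
by rewrite add0e.
Qed.

Lemma exit_above_prob_ge0 p th N w : 0 <= exit_above_prob p th N w.
Proof.
by apply: sume_ge0 => l _; apply: iint_ge0 => ys; rewrite lee_fin.
Qed.

(** A walk that leaves [0, 1) upwards is at height at least 1, where ruin has probability at most
    [e^(- s)]; hence each such exit saves [h (1 - e^(- s))]. *)
Lemma arm_value_exit_above p th h s N n w :
  (0 <= h)%R -> (0 <= s)%R -> (0 <= w)%R ->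
  \int[p]_x (expR (- s * (x - th)))%:E <= 1 ->
  arm_value p 0 th h n w + (h * (1 - expR (- s)))%:E * exit_above_prob p th N w <= h%:E.
Proof.
move=> h0 s0 + mom.
have k0 : (0 <= h * (1 - expR (- s)))%R.
  by rewrite mulr_ge0// subr_ge0 expR_le1 oppr_le0.
set k := (h * (1 - expR (- s)))%R in k0 *.
elim: N n w => [|N IH] n w w0.
  by rewrite /exit_above_prob big_ord0 mule0 adde0; exact: arm_value_le.
have av0 n' w' : 0 <= arm_value p 0 th h n' w' by exact: arm_value_ge0.
(* Horizon 0 has value 0, below the value at horizon 1, so a first pull may be assumed. *)
wlog [n' ->] : n / exists n', n = n'.+1.
  move=> H; case: n => [|n]; last by apply: H; exists n.
  apply: le_trans (H 1%N _); last by exists 0%N.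
  by rewrite leeD2r//; exact: av0.
rewrite /= add0e.
apply: le_trans (leeD2l _ (lee_wpmul2l _ (exit_above_prob_step p th N w))) _ => //.
rewrite -integralZ_nomeas//=; last first.
  by move=> x; case: ifP => // _; case: ifP => // _; exact: exit_above_prob_ge0.
apply: le_trans (le_integralD_nomeas _ _ _) _ => /=.
- by move=> x; case: ifP.
- move=> x; rewrite mule_ge0//; case: ifP => // _; case: ifP => // _.
  exact: exit_above_prob_ge0.
apply: integral_prob_le => // x; case: ltP => w'0; first by rewrite mule0 adde0.
case: (leP 1%R (w + (x - th))%R) => w'1; last exact: IH.
rewrite mule1; apply: (@le_trans _ _ ((h * expR (- s))%:E + k%:E)).
  rewrite leeD2r//; apply: le_trans (arm_value_upward n' h0 s0 w'0 mom) _.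
  by rewrite lee_fin ler_wpM2l// ler_expR mulNr lerN2 ler_peMr.
by rewrite -EFinD lee_fin /k; lra.
Qed.

Lemma keep_hit_up p th h s (p0 : R) n : (0 <= h)%R -> (0 <= s)%R ->
  \int[p]_x (expR (- s * (x - th)))%:E <= 1 ->
  p0%:E <= hit_up_prob p th ->
  arm_value p 0 th h n 0 <= ((1 - p0 * (1 - expR (- s))) * h)%:E.
Proof.
move=> h0 s0 mom p0_le.
have k0 : (0 <= h * (1 - expR (- s)))%R.
  by rewrite mulr_ge0// subr_ge0 expR_le1 oppr_le0.
set k := (h * (1 - expR (- s)))%R in k0 *.
suff : arm_value p 0 th h n 0 + k%:E * p0%:E <= h%:E.
  rewrite -EFinM -leeBrDr// => /le_trans; apply.
  by rewrite -EFinB lee_fin /k; lra.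
have [<-|kn0] := eqVneq 0%R k; first by rewrite mul0e adde0; exact: arm_value_le.
have kp : (0 < k)%R by rewrite lt_neqAle kn0.
have vfin : arm_value p 0 th h n 0 \is a fin_num.
  rewrite ge0_fin_numE ?arm_value_ge0//.
  by apply: le_lt_trans (arm_value_le p th n 0 h0) _; rewrite ltry.
rewrite addeC -leeBrDr// -lee_pdivlMl//; apply: le_trans p0_le _.
apply: lime_le.
  apply: is_cvg_nneseries => l _ _.
  by apply: iint_ge0 => ys; rewrite lee_fin.
apply: nearW => N; rewrite lee_pdivlMl// leeBrDr// addeC.
apply: le_trans (arm_value_exit_above N n h0 s0 (lexx 0%R) mom).
rewrite leeD2l// lee_wpmul2l// big_mkord; apply: lee_sum => l _.
apply: (@le_iint _ (nseq l.+1 p)) => ys; rewrite lee_fin//.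
by have := @hit_up_at_exits_above th l ys; case: hit_up_at => [->//|_]; rewrite ler0n.
Qed.

(** The definition is applied at [1 - 2 dl], between [dl] and [2 dl] below [mu]. For an upward exit,
    [s = 2 dl] is admissible and [1 - e^(- 2 dl) >= dl]. *)
Lemma keep_upward_looking p mu dl (p0 : R) h n : (0 <= p0)%R ->
  upward_looking p mu p0 -> (0 < dl <= 1 / 4)%R -> (64 * dl <= p0)%R -> (p0 * dl <= 1)%R ->
  (1 - dl <= mu <= 1)%R -> (0 <= h)%R ->
  arm_value p 0 (1 - 2 * dl) h n 0 <= ((1 - p0 * dl) * h)%:E.
Proof.
move=> p00 [_ [sg up]] /andP[dl0 dl4] dlp0 p0dl /andP[mul mur] h0.
have [|hit|pos] := up (1 - 2 * dl)%R; first by lra.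
  have s0 : (0 <= 2 * dl)%R by lra.
  have mom : \int[p]_x (expR (- (2 * dl) * (x - (1 - 2 * dl))))%:E <= 1.
    by apply: (@subgaussian1_drift _ p mu _ dl) => //; lra.
  apply: le_trans (keep_hit_up n h0 s0 mom hit) _.
  rewrite lee_fin ler_wpM2r// lerD2l lerN2 ler_wpM2l//.
  have : (expR (- (2 * dl)) <= 1 - 2 * dl / 2)%R by apply: expRN_le_half; lra.
  lra.
by apply: (@keep_positive_part _ p mu) => //; lra.
Qed.

End UpwardLooking.

(** * Averaging over the prior *)

Section BayesRegretBound.
Variable R : realType.
Local Open Scope ereal_scope.
Implicit Types (P : R -> probability R R) (G : probability R R) (mu dl r h : R) (J T k : nat).

(** At zero pull cost the value is [h] times the probability of abandonment, so [r] is a lower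
    bound, uniform in the horizon, on the probability of keeping a good arm. *)
Definition keeps P dl r := forall mu h n, (1 - dl <= mu <= 1)%R -> (0 <= h)%R ->
  arm_value (P mu) 0 (1 - 2 * dl) h n 0 <= ((1 - r) * h)%:E.

(* Dyadic step function dominating 1 / (1 - mu) for 2 ^- J < 1 - mu. *)
Definition dyadic_inv_gap J mu : R :=
  (\sum_(j < J) 2 ^+ j.+1 * \1_(`[(1 - 2 ^- j)%R, +oo[%classic) mu)%R.

Definition abandon_weight dl r mu : R := (1 - r * \1_(`[(1 - dl)%R, +oo[%classic) mu)%R.

Lemma indic_itv_ge (a x : R) : \1_(`[a, +oo[%classic) x = (a <= x)%R%:R :> R.
Proof. by rewrite indicE /= mem_setE in_itv /= andbT. Qed.

Lemma dyadic_inv_gap_ge0 J mu : (0 <= dyadic_inv_gap J mu)%R.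
Proof. by apply: sumr_ge0 => j _; rewrite mulr_ge0// ?exprn_ge0// indicE ler0n. Qed.

Lemma inv_gap_le_dyadic J mu : (2 ^- J < 1 - mu <= 1)%R ->
  ((1 - mu)^-1 <= dyadic_inv_gap J mu)%R.
Proof.
elim: J => [|J IH] /andP[gap gap1]; first by move: gap; rewrite expr0 invr1; lra.
have gap0 : (0 < 1 - mu)%R by apply: lt_trans gap; rewrite invr_gt0 exprn_gt0.
rewrite /dyadic_inv_gap big_ord_recr /= indic_itv_ge.
have [small|large] := leP (1 - 2 ^- J)%R mu.
  rewrite mulr1; apply: (@le_trans _ _ (2 ^+ J.+1)%R).
    rewrite -[leRHS]invrK lef_pV2 ?posrE// ?invr_gt0 ?exprn_gt0//.
    exact: ltW.
  by rewrite lerDr; exact: dyadic_inv_gap_ge0.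
by rewrite mulr0 addr0; apply: IH; apply/andP; split => //; lra.
Qed.

Lemma abandon_weight_ge0 dl r mu : (0 <= r <= 1)%R -> (0 <= abandon_weight dl r mu)%R.
Proof.
move=> /andP[r0 r1]; rewrite /abandon_weight indic_itv_ge.
by case: (leP (1 - dl)%R mu) => _; rewrite ?mulr0 ?mulr1 ?subr0// subr_ge0.
Qed.

Lemma arm_value_bound P dl r J T mu h : (0 < dl)%R -> (0 <= r)%R ->
  (2 ^- J <= 3 * dl)%R -> keeps P dl r -> subgaussian1 (P mu) mu ->
  (0 <= mu <= 1)%R -> (0 <= h)%R ->
  arm_value (P mu) (big_gap dl mu) (1 - 2 * dl) h T 0 <=
  (36 * dyadic_inv_gap J mu + abandon_weight dl r mu * h)%:E.
Proof.
move=> dl0 r0 J3 keep sg /andP[mu0 mu1] h0; have dy0 := dyadic_inv_gap_ge0 J mu.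
rewrite /abandon_weight indic_itv_ge /big_gap.
case: ifPn => [gap|_]; last first.
  apply: (@le_trans _ _ ((1 - r * (1 - dl <= mu)%R%:R) * h)%:E); last first.
    by rewrite lee_fin lerDr mulr_ge0.
  case: (leP (1 - dl)%R mu) => mudl; first by rewrite mulr1; apply: keep => //; rewrite mudl.
  by rewrite mulr0 subr0 mul1r; exact: arm_value_le.
have dlmu : (1 - dl <= mu)%R = false by apply/negbTE; rewrite -ltNge; lra.
rewrite dlmu mulr0 subr0 mul1r [(36 * _ + h)%R]addrC.
set g := (1 - mu)%R in gap *.
have g1 : (g <= 1)%R by rewrite /g; lra.
have g0 : (0 < g)%R by lra.
(* The drift is [- s], and [s >= g / 3] since [g > 3 dl]. The exponential of rate [s] contracts by
   [rho <= 1 - s^2 / 4], so the arm costs at most [4 g / s^2 <= 36 / g]. *)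
set s := (g - 2 * dl)%R.
have s0 : (0 < s)%R by rewrite /s; lra.
have s1 : (s <= 1)%R by rewrite /s; lra.
have sg3 : (g / 3 <= s)%R by rewrite /s; lra.
have s201 : (0 <= s ^+ 2 / 2 <= 1)%R by apply/andP; split; nra.
set rho := (expR (- (s ^+ 2 / 2)))%R.
have rho_le : (rho <= 1 - s ^+ 2 / 2 / 2)%R by exact: expRN_le_half.
have s2_gt0 : (0 < s ^+ 2)%R by rewrite exprn_gt0.
have mom : \int[P mu]_x (expR (s * (x - (1 - 2 * dl))))%:E <= rho%:E.
  apply: le_trans (subgaussian1_shift _ _ sg) _.
  rewrite lee_fin ler_expR.
  have -> : (mu - (1 - 2 * dl) = - s)%R by rewrite /s /g; lra.
  nra.
have rho01 : (0 <= rho < 1)%R by rewrite expR_ge0/=; lra.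
apply: le_trans (arm_value_downward T (ltW g0) h0 (ltW s0) rho01 mom) _.
rewrite lee_fin lerD2l.
have invg : (g^-1 <= dyadic_inv_gap J mu)%R.
  by apply: inv_gap_le_dyadic; rewrite -/g g1 andbT; lra.
apply: (@le_trans _ _ (36 * g^-1)%R); last by rewrite ler_wpM2l.
rewrite ler_pdivrMr; last by lra.
rewrite mulrAC ler_pdivlMr//.
nra.
Qed.

Fixpoint explore_bound dl r J T (mus : seq R) : R :=
  match mus with
  | [::] => T%:R
  | mu :: mus' => 36 * dyadic_inv_gap J mu +
                  abandon_weight dl r mu * explore_bound dl r J T mus'
  end%R.

Lemma explore_bound_ge0 dl r J T mus : (0 <= r <= 1)%R ->
  (0 <= explore_bound dl r J T mus)%R.
Proof.
move=> r01; elim: mus => [|mu mus IH] /=; first exact: ler0n.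
by rewrite addr_ge0 ?mulr_ge0 ?dyadic_inv_gap_ge0 ?abandon_weight_ge0.
Qed.

Lemma iint_explore_cost P dl r J T mus : (0 < dl)%R -> (0 <= r <= 1)%R ->
  (2 ^- J <= 3 * dl)%R -> keeps P dl r -> family_subgaussian1 P ->
  all (fun mu => 0 <= mu <= 1)%R mus ->
  iint (flatten [seq nseq T (P mu) | mu <- mus])
    (fun xs => (explore_cost dl T mus xs)%:E) <= (explore_bound dl r J T mus)%:E.
Proof.
move=> dl0 r01 J3 keep sg; elim: mus => [|mu mus IH] //= /andP[mu01 mus01].
apply: le_trans (@iint_arm_cost _ (P mu) _ _ _ _ _ T 0%R _ _ _ (IH mus01)) _.
- exact/big_gap_ge0/ltW.
- exact: explore_bound_ge0.
- by move=> ys; exact/explore_cost_ge0/ltW.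
apply: arm_value_bound => //; last exact: explore_bound_ge0.
- by case/andP: r01.
- exact: sg.
Qed.

(** Each dyadic scale contributes at most [2^(j+1) C0 2^(-j) = 2 C0]; the number of scales is the
    source of the logarithm. *)
Lemma integral_dyadic_inv_gap G (C0 : R) J :
  (forall eps, (0 < eps <= 1)%R -> G `[(1 - eps)%R, +oo[%classic <= (C0 * eps)%:E) ->
  \int[G]_mu (dyadic_inv_gap J mu)%:E <= (2 * C0 * J%:R)%:E.
Proof.
move=> GC.
under eq_integral do rewrite /dyadic_inv_gap -sumEFin.
rewrite ge0_integral_sum//; last first.
  by move=> j; apply/measurable_EFinP/measurable_funM.
apply: (@le_trans _ _ (\sum_(j < J) (2 * C0)%:E)); last first.
  by rewrite sumEFin sumr_const card_ord -(mulr_natr (2 * C0)%R).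
apply: lee_sum => j _; under eq_integral do rewrite EFinM.
have p0 : (0 < 2 ^+ j :> R)%R by rewrite exprn_gt0.
rewrite integralZ_nomeas ?exprn_ge0//.
rewrite integral_indic// setIT.
apply: le_trans (lee_wpmul2l _ (GC _ _)) _; rewrite ?lee_fin ?exprn_ge0//.
  rewrite invr_gt0 p0/= invf_le1// exprn_ege1// ler1n//.
by rewrite exprS -mulrA [(C0 * _)%R]mulrC mulVKf// gt_eqF.
Qed.

Lemma integral_abandon_weight G dl r (c0 : R) : (0 <= r <= 1)%R ->
  (c0 * dl)%:E <= G `[(1 - dl)%R, +oo[%classic ->
  \int[G]_mu (abandon_weight dl r mu)%:E <= (1 - r * (c0 * dl))%:E.
Proof.
move=> r01 Gc; have /andP[r0 r1] := r01.
rewrite EFinB leeBrDr//.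
apply: (@le_trans _ _ (\int[G]_mu (abandon_weight dl r mu)%:E +
    r%:E * \int[G]_mu (\1_(`[(1 - dl)%R, +oo[%classic) mu)%:E)).
  rewrite leeD2l// EFinM lee_wpmul2l// integral_indic// setIT//.
have i0 x : 0 <= (\1_(`[(1 - dl)%R, +oo[%classic : set R) x : R)%:E.
  by rewrite lee_fin indicE ler0n.
rewrite -integralZ_nomeas//.
apply: le_trans (le_integralD_nomeas _ _ _) _ => //.
- by move=> x; rewrite lee_fin abandon_weight_ge0.
- by move=> x; rewrite mule_ge0.
apply: integral_prob_le => // x.
by rewrite -EFinM -EFinD lee_fin /abandon_weight subrK.
Qed.

(** Integrating out one mean gives [B_(k+1) <= A + (1 - q) B_k] with [A = 72 C0 J]. The fixed point
    is [A / q], and the initial value [T] decays at least as fast as [e^(- q k)]. *)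
Lemma iint_explore_bound G dl r J T k (c0 C0 : R) : (0 < dl <= 1)%R -> (0 < r <= 1)%R ->
  (0 < c0 < C0)%R ->
  (c0 * dl)%:E <= G `[(1 - dl)%R, +oo[%classic ->
  (forall eps, (0 < eps <= 1)%R -> G `[(1 - eps)%R, +oo[%classic <= (C0 * eps)%:E) ->
  iint (nseq k G) (fun mus => (explore_bound dl r J T mus)%:E) <=
  (72 * C0 * J%:R / (r * (c0 * dl)) + T%:R * expR (- (r * (c0 * dl) * k%:R)))%:E.
Proof.
move=> /andP[dl0 dl1] /andP[r0 r1] /andP[c00 cC] Gc GC.
have r01 : (0 <= r <= 1)%R by rewrite ltW.
have C00 : (0 < C0)%R by exact: lt_trans cC.
set q := (r * (c0 * dl))%R.
have q0 : (0 < q)%R by rewrite !mulr_gt0.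
set A := (72 * C0 * J%:R)%R.
have A0 : (0 <= A)%R by rewrite !mulr_ge0// ltW.
elim: k => [|k IH] /=.
  by rewrite lee_fin mulr0 oppr0 expR0 mulr1 lerDr divr_ge0// ltW.
set B := (A / q + _)%R in IH.
have B0 : (0 <= B)%R by rewrite addr_ge0// ?divr_ge0// ?mulr_ge0 ?expR_ge0// ltW.
have dm : measurable_fun setT (fun mu => (36 * dyadic_inv_gap J mu)%:E : \bar R).
  apply/measurable_EFinP/measurable_funM => //; apply: measurable_sum => j.
  exact: measurable_funM.
have am : measurable_fun setT (fun mu => (abandon_weight dl r mu * B)%:E : \bar R).
  apply/measurable_EFinP/measurable_funM => //; apply: measurable_funB => //.
  exact: measurable_funM.
apply: (@le_trans _ _ (\int[G]_mu ((36 * dyadic_inv_gap J mu)%:E +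
    (abandon_weight dl r mu * B)%:E))).
  have d0 x : (0 <= 36 * dyadic_inv_gap J x)%R by rewrite mulr_ge0 ?dyadic_inv_gap_ge0.
  have a0 x : (0 <= abandon_weight dl r x)%R by exact: abandon_weight_ge0.
  apply: le_integral_nomeas => x; first by rewrite -EFinD lee_fin addr_ge0// mulr_ge0.
  apply: (@le_trans _ _ ((36 * dyadic_inv_gap J x)%:E +
     iint (nseq k G) (fun mus => (abandon_weight dl r x)%:E * (explore_bound dl r J T mus)%:E))).
    apply: (@iint_addl _ (nseq k G) _ (fun mus => (abandon_weight dl r x)%:E *
       (explore_bound dl r J T mus)%:E)) => // xs.
    by rewrite -EFinM lee_fin mulr_ge0// explore_bound_ge0.
  rewrite leeD2l// iintZ//; last by move=> xs; rewrite lee_fin explore_bound_ge0.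
  by rewrite EFinM lee_wpmul2l ?lee_fin.
rewrite ge0_integralD//; last 2 first.
- by move=> x _; rewrite lee_fin mulr_ge0 ?dyadic_inv_gap_ge0.
- by move=> x _; rewrite lee_fin mulr_ge0 ?abandon_weight_ge0.
under eq_integral do rewrite EFinM.
under [X in _ + X]eq_integral do rewrite mulrC EFinM.
rewrite !integralZ_nomeas//; last 2 first.
- by move=> x; rewrite lee_fin abandon_weight_ge0.
- by move=> x; rewrite lee_fin dyadic_inv_gap_ge0.
apply: (@le_trans _ _ (36%:E * (2 * C0 * J%:R)%:E + B%:E * (1 - q)%:E)).
  apply: leeD; rewrite lee_wpmul2l//; first exact: integral_dyadic_inv_gap.
  exact: integral_abandon_weight.
rewrite -!EFinM -EFinD lee_fin.
have -> : (36 * (2 * C0 * J%:R) = A)%R by rewrite /A; ring.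
rewrite -(natr1 k) (mulrDr q) mulr1 opprD expRD.
have eq1 : (1 - q <= expR (- q))%R by have := expR_ge1Dx (- q)%R.
have Te0 : (0 <= T%:R * expR (- (q * k%:R)))%R by rewrite mulr_ge0 ?expR_ge0.
have := ler_wpM2l Te0 eq1.
have -> : (B * (1 - q) = A / q - A + T%:R * expR (- (q * k%:R)) * (1 - q))%R.
  by rewrite /B; field; rewrite gt_eqF.
lra.
Qed.

Lemma tape_distsE P T k mus : size mus = k ->
  tape_dists P T k mus = flatten [seq nseq T (P mu) | mu <- mus].
Proof.
move=> <-; rewrite /tape_dists; congr flatten.
by rewrite -[in RHS](mkseq_nth 0%R mus) /mkseq -map_comp.
Qed.

Lemma prior01_setC G : prior_with_density G -> G (~` `[0%R, 1%R])%classic = 0.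
Proof. by case=> G1 _; rewrite probability_setC// G1 subee. Qed.

Lemma BR_seq_greedy_le_horizon P G T k dl : prior_with_density G -> (0 < k)%N ->
  BR_seq_greedy P G T k (2 * dl) <= T%:R%:E.
Proof.
move=> prior k0; rewrite -[leRHS](iint_cst (nseq k G)).
apply: (le_iint_nseq_on _ (prior01_setC prior)) => // mus szmus mus01.
rewrite -[leRHS](iint_cst (tape_dists P T k mus)).
apply: le_iint => // xs; rewrite lee_fin.
have nth01 i : (0 <= nth 0 mus i <= 1)%R.
  have [ik|ik] := ltnP i (size mus); last by rewrite nth_default// lexx ler01.
  by have := mus01 _ (mem_nth 0%R ik); rewrite /= in_itv.
rewrite /realized_regret lerBlDr -[leLHS]addr0 lerD//.
  rewrite ler_piMr//; apply: (big_ind (fun x => x <= 1)%R) => [|x y x1 y1|i _].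
  - by case/andP: (nth01 0%N).
  - by rewrite ge_max x1.
  - by case/andP: (nth01 i).
by apply: sumr_ge0 => a _; case/andP: (nth01 a).
Qed.

Lemma BR_seq_greedy_le P G dl r J T k (c0 C0 : R) :
  prior_with_density G -> family_subgaussian1 P ->
  (0 < dl <= 1)%R -> (0 < r <= 1)%R -> (0 < c0 < C0)%R -> (2 ^- J <= 3 * dl)%R ->
  (c0 * dl)%:E <= G `[(1 - dl)%R, +oo[%classic ->
  (forall eps, (0 < eps <= 1)%R -> G `[(1 - eps)%R, +oo[%classic <= (C0 * eps)%:E) ->
  keeps P dl r -> (0 < T)%N -> (0 < k)%N ->
  BR_seq_greedy P G T k (2 * dl) <=
  (3 * dl * T%:R + (72 * C0 * J%:R / (r * (c0 * dl)) +
    T%:R * expR (- (r * (c0 * dl) * k%:R))))%:E.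
Proof.
move=> prior sg dl01 r01 cC J3 Gc GC keep T0 k0.
have [/andP[dl0 _] /andP[r0 r1]] := (dl01, r01).
have r01' : (0 <= r <= 1)%R by rewrite ltW.
have c3 : (0 <= 3 * dl * T%:R)%R by rewrite !mulr_ge0// ltW.
rewrite EFinD; apply: le_trans (leeD2l _ (iint_explore_bound _ _ _ dl01 r01 cC Gc GC)).
apply: le_trans; last apply: iint_addl => //; last first.
  by move=> xs; rewrite lee_fin explore_bound_ge0.
apply: (le_iint_nseq_on _ (prior01_setC prior)) => //.
  by move=> xs; rewrite -EFinD lee_fin addr_ge0// explore_bound_ge0.
move=> mus szmus mus01; rewrite (tape_distsE _ _ szmus).
have mus_all : all (fun mu => 0 <= mu <= 1)%R mus.
  by apply/allP => x /mus01; rewrite /= in_itv.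
apply: le_trans (leeD2l _ (iint_explore_cost _ dl0 r01' J3 keep sg mus_all)).
have ec0 xs : 0 <= (explore_cost dl T mus xs)%:E.
  by rewrite lee_fin explore_cost_ge0// ltW.
apply: le_trans; last apply: iint_addl => //.
apply: le_iint => xs; first by rewrite adde_ge0.
rewrite -EFinD lee_fin -szmus; apply: realized_regret_le => //; first exact: ltW.
by rewrite -size_eq0 szmus -lt0n.
Qed.

End BayesRegretBound.

(** * Choice of delta and the resulting rates *)

Section Rate.
Variable R : realType.
Implicit Types (P : R -> probability R R) (G : probability R R) (T k m : nat).

Lemma ln_ge_half_log2 (n : nat) (x : R) : 2 ^+ n <= x -> n%:R / 2 <= ln x.
Proof.
move=> nx; have p0 : (0 : R) < 2 ^+ n by rewrite exprn_gt0.
rewrite -ler_expR lnK ?posrE ?(lt_le_trans p0)//; apply: le_trans nx.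
have -> : n%:R / 2 = n%:R * (1 / 2) :> R by rewrite div1r.
by rewrite expRM_natl lerXn2r ?nnegrE ?expR_ge0// expR_half_le2.
Qed.

Lemma dyadic_scale T : (0 < T)%N ->
  exists2 J : nat, (T%:R : R) <= 2 ^+ J & (J%:R : R) <= 2 * (1 + ln T%:R).
Proof.
move=> T0; exists (trunc_log 2 T).+1.
  by rewrite -natrX ler_nat ltnW// trunc_log_ltn.
have : (trunc_log 2 T)%:R / 2 <= ln T%:R :> R.
  by apply: ln_ge_half_log2; rewrite -natrX ler_nat trunc_logP.
rewrite -(natr1 (trunc_log 2 T)); lra.
Qed.

(** With keeping probability of order [dl^m], [q] is of order [dl^(m+1)]. The two conditions on
    [level] make running out of arms unlikely and keep the exploration cost [log T / q] below
    [T * level], up to logarithms. *)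
Lemma seq_greedy_rate_of_keeps P G m (kap dstar : R) (level bound : nat -> nat -> R) :
  prior_with_density G -> regular1 G -> family_subgaussian1 P ->
  0 < kap <= 1 -> 0 < dstar <= 1 ->
  (forall dl, 0 < dl <= dstar -> keeps P dl (kap * dl ^+ m)) ->
  (forall T k, (0 < T)%N -> (0 < k)%N ->
     [/\ 0 < level T k, bound T k = T%:R * level T k,
         1 <= k%:R * level T k ^+ m.+1 & 1 <= T%:R * level T k ^+ m.+2]) ->
  seq_greedy_rate P G level bound.
Proof.
move=> prior [c0 [C0 [c0C0 tail]]] sg /andP[kap0 kap1] /andP[ds0 ds1] keep lev.
have /andP[c00 cC] := c0C0.
have C00 : 0 < C0 by exact: lt_trans cC.
have kc0 : 0 < kap * c0 by rewrite mulr_gt0.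
(* [D] ensures [kap c0 D >= 1], so that [q k >= ln T] below. *)
pose D := 1 + (kap * c0)^-1.
have D1 : 1 <= D by rewrite lerDl invr_ge0 ltW.
have D0 : 0 < D by lra.
have kcD : 1 <= kap * c0 * D by rewrite mulrDr mulfV ?gt_eqF//; lra.
pose K := 144 * C0 / (kap * c0).
have K0 : 0 <= K by rewrite divr_ge0// ?mulr_ge0// ltW.
have Dds0 : 0 <= D / dstar by rewrite divr_ge0 ?ltW.
(* The summands pay for small gaps, for the case [dl > dstar], for exploration and for running out
   of arms. *)
pose C := 3 * D + D / dstar + K + 1.
have C1 : 1 <= C by rewrite /C; lra.
have DC : D <= C by rewrite /C; lra.
pose L T k : R := 1 + ln (T + k)%:R.
have L1 T k : (0 < T)%N -> 1 <= L T k.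
  by move=> T0; rewrite lerDl ln_ge0// ler1n addn_gt0 T0.
have LT T k : (0 < T)%N -> 1 + ln T%:R <= L T k.
  by move=> T0; rewrite lerD2l ler_ln ?posrE ?ltr0n ?addn_gt0 ?T0// ler_nat leq_addr.
exists C, 1%N, (fun T k => D * L T k * level T k).
split; first by lra.
have polyE T k : polylog R 1 T k = L T k by rewrite /polylog expr1.
split=> T k T0 k0; rewrite polyE; have := lev T k T0 k0; have := L1 T k T0;
    have := LT T k T0; move: (L T k) => l lT l1 [lv0 bE klv Tlv].
  have l0 : 0 < l by lra.
  have Cl1 : 1 <= C * l by rewrite mulr_ege1.
  have Dl1 : 1 <= D * l by rewrite mulr_ege1.
  apply/andP; split.
    rewrite ler_pdivrMr; last by lra.
    have : 1 <= D * l * (C * l) by rewrite mulr_ege1.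
    move/(ler_wpM2r (ltW lv0)); lra.
  by rewrite (ler_wpM2r (ltW lv0))// (ler_wpM2r (ltW l0)).
have l0 : 0 < l by lra.
set lv := level T k in lv0 bE klv Tlv *.
set b := bound T k in bE *.
have TR : 1 <= T%:R :> R by rewrite ler1n.
have T0R : 0 < T%:R :> R by lra.
have Dl1 : 1 <= D * l by rewrite mulr_ege1.
have lvdl : lv <= D * l * lv by rewrite ler_peMl// ltW.
have b1 : 1 <= b.
  rewrite bE; have [lvle1|lvge1] := leP lv 1; last by rewrite mulr_ege1// ltW.
  apply: le_trans Tlv _; rewrite (ler_wpM2l (ltW T0R))// exprS (ler_piMr (ltW lv0))//.
  by rewrite exprn_ile1// ltW.
have lb1 : 1 <= l * b by rewrite mulr_ege1.
have b0 : 0 <= b by lra.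
set dl := D * l * lv in lvdl *.
have dl0 : 0 < dl by lra.
have Tdl : T%:R * dl = D * (l * b) by rewrite /dl bE; ring.
(* When [dl] exceeds [dstar], the trivial bound [T <= T dl / dstar] suffices. *)
have [dlds|dsdl] := leP dl dstar; last first.
  apply: le_trans (BR_seq_greedy_le_horizon _ _ _ prior k0) _.
  rewrite lee_fin; apply: (@le_trans _ _ (T%:R * dl / dstar)).
    by rewrite ler_pdivlMr// (ler_wpM2l (ltW T0R))// ltW.
  rewrite Tdl [D * _ / _]mulrAC -[leRHS]mulrA.
  by have := ler_wpM2r (le_trans ler01 lb1) (_ : D / dstar <= C); apply; rewrite /C; lra.
have dl1 : dl <= 1 by lra.
have [J TJ JL] := dyadic_scale T0.
have r0 : 0 < kap * dl ^+ m by rewrite mulr_gt0// exprn_gt0.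
have r1 : kap * dl ^+ m <= 1.
  by rewrite mulr_ile1 ?(ltW kap0) ?exprn_ge0 ?exprn_ile1 ?(ltW dl0).
(* Here [2^(-J) <= 1 / T <= lv <= dl], the middle bound because [T lv = b >= 1]. *)
have J3 : 2 ^- J <= 3 * dl.
  apply: (@le_trans _ _ lv); last by lra.
  have : 1 <= T%:R * lv by rewrite -bE.
  rewrite mulrC -ler_pdivrMr// div1r; apply: le_trans.
  by rewrite lef_pV2 ?posrE// exprn_gt0.
have tail1 : ((c0 * dl)%:E <= G `[(1 - dl)%R, +oo[%classic)%E.
  by have [|h1 [h2 _]] := tail dl; [rewrite dl0|exact: le_trans h1 h2].
have tail2 e : 0 < e <= 1 -> (G `[(1 - e)%R, +oo[%classic <= (C0 * e)%:E)%E.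
  by move=> /tail[_ []].
have keepdl : keeps P dl (kap * dl ^+ m) by apply: keep; rewrite dl0.
apply: le_trans (@BR_seq_greedy_le _ P G dl _ J T k c0 C0 prior sg _ _ c0C0 J3
  tail1 tail2 keepdl T0 k0) _; rewrite ?dl0 ?r0// lee_fin.
set q := kap * dl ^+ m * (c0 * dl).
have qE : q = kap * c0 * dl ^+ m.+1 by rewrite /q exprS; ring.
have lvm0 : 0 < lv ^+ m.+1 by rewrite exprn_gt0.
have dlm : lv ^+ m.+1 <= dl ^+ m.+1 by rewrite lerXn2r ?nnegrE ?(ltW lv0) ?(ltW dl0).
have q0 : 0 < q by rewrite mulr_gt0// mulr_gt0.
have explore : 72 * C0 * J%:R / q <= K * (l * b).
  rewrite ler_pdivrMr//.
  have -> : K * (l * b) * q = 144 * C0 * l * (b * dl ^+ m.+1).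
    by rewrite qE /K; field; rewrite !gt_eqF.
  have bd : 1 <= b * dl ^+ m.+1.
    apply: le_trans Tlv _; rewrite exprS mulrA -bE ler_wpM2l//.
  have Jl : J%:R <= 2 * l by lra.
  apply: (@le_trans _ _ (72 * C0 * (2 * l))).
    by rewrite ler_wpM2l// mulr_ge0// ltW.
  have -> : 72 * C0 * (2 * l) = 144 * C0 * l * 1 by ring.
  by rewrite ler_wpM2l// !mulr_ge0// ltW.
have exhaust : T%:R * expR (- (q * k%:R)) <= 1.
  have lnq : ln T%:R <= q * k%:R.
    apply: (@le_trans _ _ l); first by lra.
    have -> : q * k%:R = kap * c0 * (D * l) ^+ m.+1 * (k%:R * lv ^+ m.+1).
      by rewrite qE /dl exprMn; ring.
    apply: (@le_trans _ _ (kap * c0 * (D * l) ^+ m.+1)).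
      apply: (@le_trans _ _ (kap * c0 * (D * l))); first by rewrite mulrA ler_peMl// ltW.
      by rewrite (ler_wpM2l (ltW kc0))// exprS ler_peMr ?exprn_ege1//; lra.
    by rewrite ler_peMr// mulr_ge0 ?exprn_ge0 ?ltW//; lra.
  apply: (@le_trans _ _ (T%:R * expR (- ln T%:R))).
    by rewrite (ler_wpM2l (ltW T0R))// ler_expR lerN2.
  by rewrite expRN lnK ?posrE// mulfV ?gt_eqF.
rewrite -[3 * dl * _]mulrA [dl * _]mulrC Tdl.
have : 0 <= D / dstar * (l * b) by rewrite mulr_ge0//; lra.
have -> : C * l * b = 3 * (D * (l * b)) + D / dstar * (l * b) + K * (l * b) + l * b.
  by rewrite /C; ring.
lra.
Qed.

(** Each of [x] and [y] saturates one constraint, and both constraints are monotone in the level. *)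
Lemma max_powR_level (T k m : nat) (x y : R) :
  0 < x -> 0 < y -> k%:R * x ^+ m.+1 = 1 -> T%:R * y ^+ m.+2 = 1 ->
  [/\ 0 < Num.max x y, Num.max (T%:R * y) (T%:R * x) = T%:R * Num.max x y,
      1 <= k%:R * Num.max x y ^+ m.+1 & 1 <= T%:R * Num.max x y ^+ m.+2].
Proof.
move=> x0 y0 kx Ty; split.
- by rewrite lt_max x0.
- by rewrite maxC maxr_pMr// ler0n.
- by rewrite -{1}kx ler_wpM2l// lerXn2r ?nnegrE ?le_max ?(ltW x0) ?(ltW y0) ?lexx.
- by rewrite -{1}Ty ler_wpM2l// lerXn2r ?nnegrE ?le_max ?(ltW x0) ?(ltW y0) ?lexx ?orbT.
Qed.

Lemma powR_root (n p : nat) : (0 < n)%N -> (0 < p)%N ->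
  n%:R * (n%:R `^ (- (1 / p%:R)) : R) ^+ p = 1.
Proof.
move=> n0 p0; have n0R : n%:R != 0 :> R by rewrite pnatr_eq0 -lt0n.
have p0R : p%:R != 0 :> R by rewrite pnatr_eq0 -lt0n.
rewrite -powR_mulrn ?powR_ge0// -powRrM mulNr div1r mulVf//.
by rewrite powR_inv1 ?ler0n// mulfV.
Qed.

Lemma powR_div (n : nat) (a b : R) : (0 < n)%N -> b = 1 + a ->
  n%:R * (n%:R `^ a) = n%:R `^ b :> R.
Proof.
move=> n0 ->; rewrite powRD; last by rewrite pnatr_eq0 -lt0n n0 implybT.
by rewrite powRr1 ?ler0n.
Qed.

End Rate.

Theorem theorem7 (R : realType) :
  (* (i) Bernoulli rewards *)
  (forall (G : probability R R) (P : R -> probability R R),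
     prior_with_density G -> regular1 G ->
     reward_family P -> family_subgaussian1 P -> bernoulli_family P ->
     seq_greedy_rate P G
       (fun T k => Num.max (k%:R^-1) (Num.sqrt T%:R)^-1)
       (fun T k => Num.max (Num.sqrt T%:R) (T%:R / k%:R))) /\
  (* (ii) general 1-subgaussian rewards *)
  (forall (G : probability R R) (P : R -> probability R R),
     prior_with_density G -> regular1 G ->
     reward_family P -> kernel_measurable P -> family_subgaussian1 P ->
     seq_greedy_rate P G
       (fun T k => Num.max (k%:R `^ (- (1 / 3))) (T%:R `^ (- (1 / 4))))
       (fun T k => Num.max (T%:R `^ (3 / 4)) (T%:R / k%:R `^ (1 / 3)))) /\
  (* (iii) uniformly upward-looking families *)
  (forall (G : probability R R) (P : R -> probability R R) (p0 d0 : R),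
     prior_with_density G -> regular1 G ->
     reward_family P -> kernel_measurable P -> family_subgaussian1 P ->
     0 < p0 -> 0 < d0 -> uniformly_upward_looking P p0 d0 ->
     seq_greedy_rate P G
       (fun T k => Num.max (k%:R `^ (- (1 / 2))) (T%:R `^ (- (1 / 3))))
       (fun T k => Num.max (T%:R `^ (2 / 3)) (T%:R / k%:R `^ (1 / 2)))).
Proof.
split; last split.
- move=> G P prior reg _ sg bern.
  (* The keeping probability is the constant 1/10, whence exponent [m = 0]. *)
  apply: (@seq_greedy_rate_of_keeps R P G 0 (1 / 10) (1 / 4)) => //; try lra.
    move=> dl dl01 mu h n mu01 h0; rewrite expr0 mulr1.
    have mu01' : 0 <= mu <= 1 by apply/andP; split; lra.
    exact: (keep_bernoulli n (bern _ mu01')).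
  move=> T k T0 k0.
  have s0 : 0 < Num.sqrt (T%:R : R) by rewrite sqrtr_gt0 ltr0n.
  have sT : Num.sqrt (T%:R : R) ^+ 2 = T%:R by rewrite sqr_sqrtr// ler0n.
  have sE : Num.sqrt (T%:R : R) = T%:R * (Num.sqrt T%:R)^-1.
    by rewrite -[X in X / _]sT expr2 mulfK// gt_eqF.
  rewrite [X in Num.max X (_ / _)]sE.
  apply: max_powR_level => //.
  + by rewrite invr_gt0 ltr0n.
  + by rewrite invr_gt0.
  + by rewrite expr1 mulfV// pnatr_eq0 -lt0n.
  + by rewrite exprVn sT mulfV// pnatr_eq0 -lt0n.
- move=> G P prior reg _ _ sg.
  (* The keeping probability is [dl^2 / 4], whence [m = 2]. *)
  apply: (@seq_greedy_rate_of_keeps R P G 2 (1 / 4) 1) => //; try lra.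
    move=> dl /andP[dl0 dl1] mu h n /andP[mu0 mu1] h0.
    have -> : 1 / 4 * dl ^+ 2 = dl ^+ 2 / 4 by rewrite mulrC div1r.
    have sgmu : subgaussian1 (P mu) mu by apply: sg; apply/andP; split; lra.
    by apply: (keep_general n sgmu _ _ h0); [rewrite dl1 ltW|lra].
  move=> T k T0 k0; rewrite -powRN.
  rewrite -(@powR_div R T (- (1 / 4)) (3 / 4))//; last by lra.
  by apply: max_powR_level; rewrite ?powR_gt0 ?ltr0n//; exact: powR_root.
- move=> G P p0 d0 prior reg _ _ sg p0_gt0 d0_gt0 up.
  (* Being upward-looking is inherited by smaller parameters, so [p0] may be capped at 1. The cap
     [ds] keeps good means within [d0] of 1 and ensures [64 dl <= kap]; here [m = 1]. *)
  pose kap := Num.min p0 1; pose ds := Num.min (Num.min (1 / 4) d0) (kap / 64).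
  have kap01 : 0 < kap <= 1 by rewrite lt_min p0_gt0 ltr01 ge_min lexx orbT.
  have [kap0 kap1] := andP kap01.
  have ds0 : 0 < ds by rewrite !lt_min d0_gt0 divr_gt0// andbT; lra.
  apply: (@seq_greedy_rate_of_keeps R P G 1 kap ds) => //.
    by rewrite ds0 /= !ge_min; apply/orP; left; apply/orP; left; lra.
    move=> dl /andP[dl0]; rewrite !le_min -andbA => /and3P[dl4 dld dlk] mu h n /andP[mu0 mu1] h0.
    have kp : kap <= p0 by rewrite ge_min lexx.
    have upk : upward_looking (P mu) mu kap.
      have [m1 [m2 m3]] : upward_looking (P mu) mu p0.
        by apply: up; rewrite mu1 andbT; lra.
      by split=> //; split=> // th /m3[H|H]; [left|right]; apply: le_trans H.
    have kdl : kap * dl <= 1 by nra.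
    have dl64 : 64 * dl <= kap by lra.
    rewrite expr1; apply: (keep_upward_looking n (ltW kap0) upk _ dl64 kdl _ h0).
      by rewrite dl0.
    by rewrite mu0.
  move=> T k T0 k0; rewrite -powRN.
  rewrite -(@powR_div R T (- (1 / 3)) (2 / 3))//; last by lra.
  by apply: max_powR_level; rewrite ?powR_gt0 ?ltr0n//; exact: powR_root.
Qed.
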